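(* Let $1/q$ be a prime power, $\Bbbk:=\mathbb{F}_{1/q}$, $\lambda$ a partition of $n$ and $\alpha$ a weak composition of $n$. (i) For every semistandard tableau $T$ of shape $\lambda$ and content $\alpha$, $$\mathrm{wt}_q(T)=\frac{q^{\binom n2-n(\lambda)}(1-q)^{-n+\lambda_1}\prod_{i\ge1}[\lambda_i-\lambda_{i+1}]_q!}{\prod_{i\ge1}[\alpha_i]_q!}\,\big|\{N\in\mathfrak{n}_\alpha:\mathrm{JF}(N;E)=T\}\big|.$$ (ii) The coefficient of $\mathbf{x}^\alpha$ in $W_\lambda(\mathbf{x};q)$ equals $$\frac{q^{\binom n2-n(\lambda)}(1-q)^{-n+\lambda_1}\prod_{i\ge1}[\lambda_i-\lambda_{i+1}]_q!}{\prod_{i\ge1}[\alpha_i]_q!}\,\big|\{N\in\mathfrak{n}_\alpha:\mathrm{JF}(N)=\lambda\}\big|.$$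
   Context: For a weak composition $\alpha=(\alpha_1,\dots,\alpha_k)$ of $n$, its $i$th block is $I_i=\{\alpha_1+\cdots+\alpha_{i-1}+1,\dots,\alpha_1+\cdots+\alpha_i\}$; $\mathfrak{n}_\alpha\subseteq\mathfrak{gl}_n(\Bbbk)$ is the space of matrices whose entry $(r,s)$ is zero whenever $r\in I_i$, $s\in I_j$ with $j\le i$ (strictly block upper triangular). $E\in\mathrm{Fl}_\alpha$ is the flag with $E_i=\langle e_1,\dots,e_{\alpha_1+\cdots+\alpha_i}\rangle$; every $N\in\mathfrak{n}_\alpha$ is strictly compatible with $E$. $n(\lambda)=\sum_i\binom{\lambda_i}{2}$. For a nilpotent $N$, $\mathrm{JF}(N)$ is the partition with $\lambda_1+\cdots+\lambda_i=\dim\ker N^i$. $\mathrm{Fl}_\alpha$, strict compatibility ($N(F_i)\subseteq F_{i-1}$), $\mathrm{JF}(N;F)$ (the semistandard tableau whose entries $\le i$ form the shape $\mathrm{JF}(N|_{F_i})$), $[m]_q!$, $\binom{m}{r}_q$, $\mathrm{wt}_q(T)=\prod_{i,j\ge1}\binom{T^{(j)}_i-T^{(j)}_{i+1}}{T^{(j)}_i-T^{(j-1)}_i}_q$ (with $T^{(j)}$ the shape of entries $\le j$) and $W_\lambda(\mathbf{x};q)=\sum_T\mathrm{wt}_q(T)\mathbf{x}^T$ are as usual: $[m]_q=1+\cdots+q^{m-1}$, $[m]_q!=\prod_{r\le m}[r]_q$, $\mathbf{x}^T=\prod_i x_i^{\#i\text{'s in }T}$, $\mathbf{x}^\alpha=\prod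 x_i^{\alpha_i}$. *)

(* Defs.v *)
From HB Require Import structures.
From mathcomp Require Import all_boot all_order all_algebra.
Set Implicit Arguments. Unset Strict Implicit. Unset Printing Implicit Defensive.
Import Order.TTheory GRing.Theory Num.Theory.
Local Open Scope ring_scope.

(* lambda_(i+1) in the paper is [part la i]; parts beyond the length are 0 *)
Definition part (la : seq nat) (i : nat) : nat := nth 0%N la i.

Definition is_partition (n : nat) (la : seq nat) : bool :=
  [&& sorted geq la, all (fun x => 0 < x)%N la & sumn la == n].

Definition is_weak_composition (n : nat) (al : seq nat) : bool := sumn al == n.

Definition nlam (la : seq nat) : nat := \sum_(x <- la) 'C(x, 2).

(* A tableau is a sequence of rows (top row first), entries are positive naturals. *)
Definition tableau := seq (seq nat).

Definition shape (T : tableau) : seq nat := map size T.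

Definition is_ssyt_shape (la : seq nat) (T : tableau) : Prop :=
  [/\ shape T = la,
      forall i, sorted leq (nth [::] T i) &
      forall i c, (c < size (nth [::] T i.+1))%N ->
        (nth 0%N (nth [::] T i) c < nth 0%N (nth [::] T i.+1) c)%N].

Definition has_content (al : seq nat) (T : tableau) : Prop :=
  forall j : nat, count_mem j (flatten T) = nth 0%N (0%N :: al) j.

Definition shape_le (j : nat) (T : tableau) : seq nat :=
  [seq x <- [seq count (fun e => e <= j)%N r | r <- T] | (0 < x)%N].

Definition qint (q : rat) (m : nat) : rat := \sum_(i < m) q ^+ i.
Definition qfact (q : rat) (m : nat) : rat := \prod_(1 <= r < m.+1) qint q r.
Definition qbinom (q : rat) (m r : nat) : rat :=
  if (r <= m)%N then qfact q m / (qfact q r * qfact q (m - r)) else 0.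

(* wt_q(T) = prod_{i,j >= 1} binom_q(T^(j)_i - T^(j)_{i+1}, T^(j)_i - T^(j-1)_i);
   all factors with i > #rows or j > max entry equal 1. *)
Definition wt (q : rat) (T : tableau) : rat :=
  \prod_(1 <= j < (foldr maxn 0%N (flatten T)).+1)
   \prod_(0 <= i < size T)
     qbinom q (part (shape_le j T) i - part (shape_le j T) i.+1)
              (part (shape_le j T) i - part (shape_le j.-1 T) i).

Section LinAlg.
Variable F : finFieldType.

(* JF(B) for a square matrix: lambda_i = dim ker B^i - dim ker B^(i-1), zero parts dropped *)
Definition JF (m : nat) (B : 'M[F]_m) : seq nat :=
  [seq x <- [seq ((m - \rank (B ^+ i)) - (m - \rank (B ^+ i.-1)))%N | i <- iota 1 m]
   | (0 < x)%N].

Definition mx_nat (n : nat) (A : 'M[F]_n) (r s : nat) : F :=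
  match @insub nat (fun k => k < n)%N 'I_n r, @insub nat (fun k => k < n)%N 'I_n s with
  | Some i, Some j => A i j
  | _, _ => 0
  end.

(* restriction of A to <e_1, ..., e_m> (top-left m x m block) *)
Definition topleft (n m : nat) (A : 'M[F]_n) : 'M[F]_m :=
  \matrix_(i < m, j < m) mx_nat A i j.

(* 0-indexed row/column r lies in block I_(i+1) of alpha *)
Definition in_block (al : seq nat) (i r : nat) : bool :=
  (sumn (take i al) <= r < sumn (take i.+1 al))%N.

(* N in n_alpha : strictly block upper triangular.
   (Blocks I_(i+1) with i >= size al are empty, so bounding i, j is harmless.) *)
Definition in_nalpha (n : nat) (al : seq nat) (N : 'M[F]_n) : bool :=
  [forall i : 'I_(size al), forall j : 'I_(size al), forall r : 'I_n, forall s : 'I_n,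
    (in_block al i r && in_block al j s && (j <= i)%N) ==> (N r s == 0)].

(* JF(N;E): the tableau whose entries <= j form the shape JF(N|_{E_j}),
   E_j = <e_1, ..., e_{alpha_1 + ... + alpha_j}>, j = 0..k *)
Definition JF_sh (n : nat) (al : seq nat) (N : 'M[F]_n) (j : nat) : seq nat :=
  JF (topleft (sumn (take j al)) N).

Definition JF_flag (n : nat) (al : seq nat) (N : 'M[F]_n) : tableau :=
  [seq flatten [seq nseq (part (JF_sh al N j) i - part (JF_sh al N j.-1) i)%N j
               | j <- iota 1 (size al)]
  | i <- iota 0 (size (JF_sh al N (size al)))].

End LinAlg.

Definition prefactor (q : rat) (n : nat) (la al : seq nat) : rat :=
  q ^ ('C(n, 2)%:Z - (nlam la)%:Z) * (1 - q) ^ ((part la 0)%:Z - n%:Z)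
  * (\prod_(0 <= i < size la) qfact q (part la i - part la i.+1))
  / (\prod_(a <- al) qfact q a).

(* Main.v *)
(* Write N in n_alpha as [[N', X], [0, 0]], where X has a columns and a is the last part of
   alpha. With S_i = rowspace(N'^i) :&: ker N' (row vectors), whose rank is the (i+1)st part
   of mu = JF(N'), one has rank N^(i+1) = rank N'^(i+1) + rank (S_i X), so that JF(N) is
   determined by mu and by the ranks of X on the flag S_0 >= S_1 >= ..., and JF(N) / mu is a
   horizontal strip. Passing from S_(i+1) to S_i one vector at a time, the new vector is sent
   by a uniformly random X to a uniform vector independent of X on the smaller space; hence
   the number of X producing a given shape is a product of q-binomials. A telescoping
   identity turns that product into the quotient of two consecutive prefactors times the
   contribution of the strip to wt_q, and (i) follows by induction on the length of alpha.
   For (ii) one sums over T, as JF(N; E) is always a semistandard tableau of content alpha. *)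
Require Import Defs.
From HB Require Import structures.
From mathcomp Require Import all_boot all_order all_algebra mxabelem.
From mathcomp Require Import zify ring lra.
Import Order.TTheory GRing.Theory Num.Theory.
Local Open Scope ring_scope.
Set Implicit Arguments. Unset Strict Implicit. Unset Printing Implicit Defensive.

(** * q-analogues *)

Section QAnalogues.
Variable q : rat.

Lemma qintS m : qint q m.+1 = 1 + q * qint q m.
Proof.
rewrite /qint big_ord_recl expr0 mulr_sumr; congr (_ + _).
by apply: eq_bigr => i _; rewrite lift0 exprS.
Qed.

Lemma qintD m k : qint q (m + k) = qint q m + q ^+ m * qint q k.
Proof.
elim: m => [|m IHm]; first by rewrite /qint big_ord0 expr0 mul1r add0r.
by rewrite addSn !qintS IHm exprS; ring.
Qed.

Lemma qint_geom m : (1 - q) * qint q m = 1 - q ^+ m.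
Proof.
elim: m => [|m IHm]; first by rewrite /qint big_ord0 mulr0 expr0 subrr.
by rewrite qintS exprS mulrDr mulrCA IHm; ring.
Qed.

Lemma qfact0 : qfact q 0 = 1.
Proof. by rewrite /qfact big_geq. Qed.

Lemma qfactS m : qfact q m.+1 = qfact q m * qint q m.+1.
Proof. by rewrite /qfact big_nat_recr. Qed.

(** The q-Pochhammer symbol (q;q)_m. *)
Definition qpoch m : rat := \prod_(u < m) (1 - q ^+ u.+1).

Lemma qpochE m : qpoch m = (1 - q) ^+ m * qfact q m.
Proof.
elim: m => [|m IHm]; first by rewrite /qpoch big_ord0 qfact0 mulr1.
rewrite /qpoch big_ord_recr /= -/(qpoch m) IHm qfactS -qint_geom exprS.
by ring.
Qed.

(** For [s > d] the factor with [t = d] is 1 - q^0, so the product vanishes: a dimension cannot grow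
    by more than the codimension. *)
Definition qfall d s : rat := \prod_(t < s) (1 - q ^+ (d - t)).

Lemma qfall_eq0 d s : (d < s)%N -> qfall d s = 0.
Proof.
by move=> lt_ds; rewrite /qfall (bigD1 (Ordinal lt_ds)) //= subnn subrr mul0r.
Qed.

Lemma qfallS d s : qfall d s.+1 = (1 - q ^+ d) * qfall d.-1 s.
Proof.
rewrite /qfall big_ord_recl subn0; congr (_ * _); apply: eq_bigr => t _.
by rewrite lift0; congr (1 - q ^+ _); lia.
Qed.

Lemma qpoch_fall d s : (qpoch d) * qfall (d + s) s = qpoch (d + s).
Proof.
elim: s => [|s IHs]; first by rewrite /qfall big_ord0 addn0 mulr1.
rewrite qfallS addnS /= mulrCA IHs /qpoch big_ord_recr /= mulrC.
by [].
Qed.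

Hypothesis q_gt0 : 0 < q.

Lemma qint_gt0 m : 0 < qint q m.+1.
Proof.
rewrite qintS ltr_pwDl // mulr_ge0 ?(ltW q_gt0) // sumr_ge0 // => i _.
by rewrite exprn_ge0 // ltW.
Qed.

Lemma qfact_neq0 m : qfact q m != 0.
Proof.
elim: m => [|m IHm]; first by rewrite qfact0 oner_eq0.
by rewrite qfactS mulf_neq0 // gt_eqF // qint_gt0.
Qed.

Lemma qbinom0 m : qbinom q m 0 = 1.
Proof. by rewrite /qbinom leq0n subn0 qfact0 mul1r divff ?qfact_neq0. Qed.

(** The q-Pascal rule; for [m = r + k + 1] it comes from the splitting [r+k+2] = [r+1] + q^(r+1)
    [k+1]. *)
Lemma qbinomS m r :
  qbinom q m.+1 r.+1 = q ^+ r.+1 * qbinom q m r.+1 + qbinom q m r.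
Proof.
rewrite /qbinom ltnS; case: (ltngtP r m) => [lt_rm|//|->]; last first.
- by rewrite !subnn qfact0 mulr0 add0r !mulr1 !divff ?qfact_neq0.
- by rewrite mulr0 addr0.
have [k ->] : exists k, m = (r + k.+1)%N by exists (m - r.+1)%N; lia.
have -> : ((r + k.+1).+1 - r.+1 = k.+1)%N by lia.
have -> : (r + k.+1 - r.+1 = k)%N by lia.
have -> : (r + k.+1 - r = k.+1)%N by lia.
rewrite (qfactS (r + k.+1)) (qfactS r) (qfactS k) -addSn qintD.
have := qfact_neq0 r; have := qfact_neq0 k.
have := lt0r_neq0 (qint_gt0 r); have := lt0r_neq0 (qint_gt0 k).
by move=> h1 h2 h3 h4; field; rewrite h1 h2 h3 h4.
Qed.

(* The probability that [c] uniformly random vectors raise by exactly [s] the dimension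
   of a fixed subspace of codimension [d] in a space over the field with [1/q] elements. *)
Definition ext_prob c d s : rat :=
  qbinom q c s * q ^+ ((d - s) * (c - s)) * qfall d s.

Lemma ext_prob0S d s : ext_prob 0 d s = (s == 0%N)%:R.
Proof.
case: s => [|s]; last by rewrite /ext_prob /qbinom ltn0 !mul0r.
by rewrite /ext_prob qbinom0 subnn muln0 /qfall big_ord0 expr0 !mulr1.
Qed.

Lemma ext_probS0 c d : ext_prob c.+1 d 0 = q ^+ d * ext_prob c d 0.
Proof.
by rewrite /ext_prob !qbinom0 !subn0 mulnS exprD /qfall !big_ord0; ring.
Qed.

(** Meaning: the first vector falls into the subspace of codimension [d] with probability q^d;
    otherwise the codimension drops to [d - 1] and [s] increases remain for the other [c] vectors.
    The proof is algebraic, by the q-Pascal rule. *)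
Lemma ext_probSS c d s : ext_prob c.+1 d s.+1 =
  q ^+ d * ext_prob c d s.+1 + (1 - q ^+ d) * ext_prob c d.-1 s.
Proof.
(* For [d <= s] both sides vanish: the factor (1 - q^d) of the last term completes [qfall q d.-1 s]
   to [qfall q d s.+1]. *)
rewrite /ext_prob; have [le_ds|lt_sd] := leqP d s.
  rewrite qfall_eq0 // !mulr0 add0r mulrCA -qfallS qfall_eq0 //.
  by rewrite mulr0.
have [e ->] : exists e, d = (e + s.+1)%N by exists (d - s.+1)%N; lia.
rewrite qfallS; set W := qfall _ s; set Z := 1 - _.
have -> : ((e + s.+1).-1 - s = e)%N by lia.
rewrite addnK subSS qbinomS.
have [lt_cs|le_sc] := ltnP c s.
  rewrite /qbinom (leqNgt s c) lt_cs (ltnNge s c) (ltnW lt_cs) /=; ring.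
have [/eqP-> | ] := boolP (c == s).
  rewrite /qbinom ltnn leqnn; ring.
move=> ne_cs; have [k ->] : exists k, c = (k + s.+1)%N by exists (c - s.+1)%N; lia.
rewrite addnK addnS subSn ?leq_addl // addnK mulnS !exprD; ring.
Qed.

End QAnalogues.

(** * Horizontal strips *)

Lemma bin2D x y : ('C(x + y, 2) = 'C(x, 2) + 'C(y, 2) + x * y)%N.
Proof.
elim: x => [|x IHx]; first by rewrite bin0n mul0n !addn0.
by rewrite addSn !binS IHx !bin1; lia.
Qed.

Section HorizontalStrip.
Variables la mu : nat -> nat.
Hypothesis le_mu_la : forall i, (mu i <= la i)%N.
Hypothesis le_la_mu : forall i, (la i.+1 <= mu i)%N.

Let strip i := (la i - mu i)%N.
Let strips i := (\sum_(j < i.+1) strip j)%N.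

(** Compares n(la) with n(mu). Past the last row, [strips L] is the size a of the strip and [mu L]
    is 0, so n(la) is n(mu) + C(a,2) plus the exponent of q produced by the extension
    probabilities. *)
Lemma strips_binomial_sum L :
  (\sum_(i < L.+1) 'C(la i, 2) = \sum_(i < L.+1) 'C(mu i, 2) + 'C(strips L, 2)
    + \sum_(i < L) strips i * (mu i - la i.+1) + strips L * mu L)%N.
Proof.
elim: L => [|L IHL].
  rewrite /strips !big_ord1 big_ord0 /strip.
  rewrite -{1}(subnK (le_mu_la 0)) bin2D; move: (la 0 - mu 0)%N => d /=; lia.
rewrite [(\sum_(i < L.+2) 'C(la i, 2))%N]big_ord_recr [(\sum_(i < L.+2) 'C(mu i, 2))%N]big_ord_recr.
rewrite [(\sum_(i < L.+1) strips i * _)%N]big_ord_recr /= IHL.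
have -> : strips L.+1 = (strips L + strip L.+1)%N by rewrite /strips big_ord_recr.
rewrite bin2D -{1}(subnK (le_mu_la L.+1)) bin2D -/(strip _).
(* Interlacing cuts mu_L into mu_L - la_(L+1), the strip in row L+1, and mu_(L+1). *)
have muE : (strips L * mu L =
    strips L * (mu L - la L.+1) + strips L * strip L.+1 + strips L * mu L.+1)%N.
  by rewrite -!mulnDr; congr muln; rewrite -addnA /strip subnK // subnK.
rewrite muE mulnDl; move: (mu L - la L.+1)%N (strips L) (strip L.+1) => u v w; ring.
Qed.

Variable q : rat.
Hypothesis q_gt0 : 0 < q.

(** Telescopes because the two binomials of index L, on mu_L - mu_(L+1) and on la_L - la_(L+1),
    share the complementary lower index mu_L - la_(L+1). The [qfall] factors assemble into
    [qpoch q (strips L)]; the last factor on each side holds the boundary terms that carry the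
    induction. *)
Lemma prod_ext_prob_aux L :
  (\prod_(i < L) ext_prob q (mu i - mu i.+1) (strips i.+1) (strip i.+1)) *
  (\prod_(i < L) qfact q (la i - la i.+1)) * (qfact q (strip L) * qpoch q (strips 0))
  = (\prod_(i < L) qfact q (mu i - mu i.+1)) *
    (\prod_(i < L) qbinom q (la i - la i.+1) (strip i)) *
    q ^+ (\sum_(i < L) strips i * (mu i - la i.+1)) *
    (qfact q (strip 0) * qpoch q (strips L)).
Proof.
elim: L => [|L IHL]; first by rewrite !big_ord0; ring.
apply: (mulfI (qfact_neq0 q_gt0 (strip L))).
rewrite 5!big_ord_recr /= exprD.
set X := bigop _ _ _ in IHL *; set A := bigop _ _ _ in IHL *.
set B := bigop _ _ _ in IHL *; set W := bigop _ _ _ in IHL *.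
set e := bigop _ _ _ in IHL *.
rewrite [LHS](_ : _ = ext_prob q (mu L - mu L.+1) (strips L.+1) (strip L.+1) *
  qfact q (la L - la L.+1) * qfact q (strip L.+1) *
  (X * A * (qfact q (strip L) * qpoch q (strips 0)))); last by ring.
rewrite IHL.
have DS : strips L.+1 = (strips L + strip L.+1)%N by rewrite /strips big_ord_recr.
have -> : qpoch q (strips L.+1) = qpoch q (strips L) * qfall q (strips L.+1) (strip L.+1).
  by rewrite DS qpoch_fall.
rewrite /ext_prob /qbinom.
have -> : (strip L.+1 <= mu L - mu L.+1)%N.
  by rewrite /strip leq_sub2r.
have -> : (strip L <= la L - la L.+1)%N.
  by rewrite /strip leq_sub2l.
have -> : (mu L - mu L.+1 - strip L.+1 = mu L - la L.+1)%N.
  by rewrite /strip; have := le_mu_la L.+1; lia.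
have -> : (la L - la L.+1 - strip L = mu L - la L.+1)%N.
  by rewrite /strip; have := le_mu_la L; have := le_la_mu L; lia.
have -> : (strips L.+1 - strip L.+1 = strips L)%N by rewrite DS addnK.
have := qfact_neq0 q_gt0 (strip L); have := qfact_neq0 q_gt0 (strip L.+1).
have := qfact_neq0 q_gt0 (mu L - la L.+1).
move=> h1 h2 h3; field; by rewrite h1 h2 h3.
Qed.

(** Writing [qpoch] as a power of 1 - q times a q-factorial lets the q-factorial of [strip 0]
    cancel. The remaining power of 1 - q accounts for the growth of the first part in the
    prefactor. *)
Lemma prod_ext_prob L a : q != 1 -> strips L = a -> strip L = 0%N ->
  (\prod_(i < L) ext_prob q (mu i - mu i.+1) (strips i.+1) (strip i.+1)) *
  (\prod_(i < L) qfact q (la i - la i.+1)) * (1 - q) ^+ strip 0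
  = (\prod_(i < L) qfact q (mu i - mu i.+1)) *
    (\prod_(i < L) qbinom q (la i - la i.+1) (strip i)) *
    q ^+ (\sum_(i < L) strips i * (mu i - la i.+1)) * ((1 - q) ^+ a * qfact q a).
Proof.
move=> q_neq1 Da dL; have := prod_ext_prob_aux L.
rewrite Da dL qfact0 mul1r.
have -> : strips 0 = strip 0 by rewrite /strips big_ord1.
rewrite (qpochE q a) (qpochE q (strip 0)) => E.
apply: (mulIf (qfact_neq0 q_gt0 (strip 0))); rewrite -[LHS]mulrA E; ring.
Qed.

End HorizontalStrip.

(** * Random extensions of a flag of subspaces *)

Lemma rank_adds_row (K : fieldType) k p (U : 'M[K]_(k, p)) (v : 'rV[K]_p) :
  ~~ (v <= U)%MS -> \rank (U + v)%MS = (\rank U).+1.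
Proof.
move=> vU; apply/eqP; rewrite eqn_leq; apply/andP; split.
  by rewrite (leq_trans (mxrank_adds_leqif U v)) // -[(\rank U).+1]addn1 leq_add2l rank_leq_row.
rewrite ltn_neqAle mxrankS ?addsmxSl // andbT.
by rewrite (mxrank_leqif_eq (addsmxSl U v)) addsmx_sub addsmxSl submx_refl /= vU.
Qed.

Section Counting.
Variables (F : finFieldType) (m a : nat).

Let Q := #|F|.
Let q : rat := Q%:R^-1.

(** Some column of the cokernel of [U] is not killed by [v]; rescaled, it is the required [w]. *)
Lemma row_avoid_col (U : 'M[F]_m) (v : 'rV[F]_m) : ~~ (v <= U)%MS ->
  exists2 w : 'cV[F]_m, U *m w = 0 & v *m w = 1%:M.
Proof.
rewrite submxE => /eqP/rowP nz.
have [j nzj]: exists j, (v *m cokermx U) 0 j != 0.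
  apply/existsP; apply: contra_notT nz; rewrite negb_exists => /forallP z j.
  by rewrite [RHS]mxE; apply/eqP; have := z j; rewrite negbK.
move: nzj; set x := (v *m cokermx U) 0 j => nzj.
exists (x^-1 *: col j (cokermx U)).
  by rewrite -scalemxAr colE mulmxA mulmx_coker mul0mx scaler0.
rewrite -scalemxAr colE mulmxA -colE [col _ _]mx11_scalar mxE -/x scale_scalar_mx.
by rewrite mulVf.
Qed.

Lemma card_submx_translate (A : 'M[F]_(m, a)) (y : 'rV[F]_a) :
  #|[set z : 'rV[F]_a | ((y + z)%R <= A)%MS]| = (Q ^ \rank A)%N.
Proof.
rewrite -card_rowg -(card_preimset (rowg A) (addrI y)); apply: eq_card => z.
by rewrite !inE.
Qed.

(* Translating [X] by [w *m z], where [w] kills [U] and [v *m w = 1], makes [v *m X]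
   uniform while keeping [U *m X] fixed. *)
Lemma card_extend_in (U : 'M[F]_m) (v : 'rV[F]_m) (P : pred 'M[F]_(m, a)) r :
    ~~ (v <= U)%MS ->
    (forall X Y, U *m X = U *m Y -> P X = P Y) ->
    (forall X, P X -> \rank (U *m X) = r) ->
  (#|[set X | P X & (v *m X <= U *m X)%MS]| * Q ^ a = #|[set X | P X]| * Q ^ r)%N.
Proof.
move=> vU PU Pr; have [w Uw vw] := row_avoid_col vU.
have Uz X (z : 'rV[F]_a) : U *m (X + w *m z) = U *m X.
  by rewrite mulmxDr mulmxA Uw mul0mx addr0.
have vz X (z : 'rV[F]_a) : v *m (X + w *m z) = v *m X + z.
  by rewrite mulmxDr mulmxA vw mul1mx.
(* The factor Q^a becomes a sum over translations [z]. After replacing [X] by [X + w *m z] in each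
   summand and exchanging the sums, a fixed [X] meets Q^r vectors [z] with [v *m X + z] in the row
   space of [U *m X]. *)
rewrite (_ : _ * _ = \sum_(z : 'rV[F]_a) #|[set X | P X & (v *m X <= U *m X)%MS]|)%N; last first.
  by rewrite sum_nat_const card_mx mul1n mulnC.
rewrite (eq_bigr (fun z => \sum_(X | P X) (((v *m X + z)%R <= U *m X)%MS : nat))%N); last first.
  move=> z _; rewrite -sum1_card (reindex_inj (addIr (w *m z))) /=.
  rewrite [RHS]big_mkcond [LHS]big_mkcond; apply: eq_bigr => X _.
  rewrite inE Uz vz (PU _ X (Uz X z)); by case: (P X); case: (_ <= _)%MS.
rewrite exchange_big /= -sum_nat_const big_mkcond [RHS]big_mkcond.
apply: eq_bigr => X _; rewrite inE; case PX: (P X) => //.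
rewrite -(Pr X PX) -(card_submx_translate (U *m X) (v *m X)) -sum1_card.
by rewrite big_mkcond [RHS]big_mkcond; apply: eq_bigr => z _; rewrite inE; case: (_ <= _)%MS.
Qed.

Lemma card_field_gt0 : (0 < Q)%N.
Proof. by apply/card_gt0P; exists 0. Qed.

Lemma inv_card_gt0 : 0 < q.
Proof. by rewrite invr_gt0 ltr0n card_field_gt0. Qed.

Lemma inv_cardX_card k : q ^+ k * (Q ^ k)%:R = 1.
Proof.
by rewrite natrX exprVn mulVf // expf_neq0 // pnatr_eq0 -lt0n card_field_gt0.
Qed.

Lemma card_extend_split (U : 'M[F]_m) (v : 'rV[F]_m) (P : pred 'M[F]_(m, a)) r :
    ~~ (v <= U)%MS ->
    (forall X Y, U *m X = U *m Y -> P X = P Y) ->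
    (forall X, P X -> \rank (U *m X) = r) ->
  #|[set X | P X & (v *m X <= U *m X)%MS]|%:R = q ^+ (a - r) * #|[set X | P X]|%:R
    :> rat /\
  #|[set X | P X & ~~ (v *m X <= U *m X)%MS]|%:R = (1 - q ^+ (a - r)) * #|[set X | P X]|%:R
    :> rat.
Proof.
move=> vU PU Pr.
have E1 : #|[set X | P X & (v *m X <= U *m X)%MS]|%:R = q ^+ (a - r) * #|[set X | P X]|%:R
    :> rat.
  have := card_extend_in vU PU Pr.
  (* The bound [r <= a], which makes [a - r] a true codimension, comes from some [X] satisfying [P];
     the empty case is therefore treated apart. *)
  have [/eqP | ] := boolP (#|[set X | P X]| == 0%N).
    move=> P0; rewrite P0 mul0n => /eqP; rewrite muln_eq0 expn_eq0.
    by rewrite (gtn_eqF card_field_gt0) /= orbF => /eqP->; rewrite mulr0.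
  rewrite -lt0n => /card_gt0P[X]; rewrite inE => /Pr rX.
  have le_ra : (r <= a)%N by rewrite -rX rank_leq_col.
  move=> /(congr1 (fun k => k%:R * q ^+ a : rat)).
  rewrite !natrM -mulrA [_%:R * q ^+ _]mulrC inv_cardX_card mulr1 => ->.
  have -> : q ^+ a = q ^+ (a - r) * q ^+ r by rewrite -exprD subnK.
  rewrite -[RHS]mulr1 -[X in _ = _ * X](inv_cardX_card r).
  move: (q ^+ r) (q ^+ _) (Q ^ r)%:R #|_|%:R => x y z t; ring.
split=> //; rewrite mulrBl mul1r -E1.
rewrite -(cardsID [set X | (v *m X <= U *m X)%MS] [set X | P X]) natrD -setIdE.
rewrite [X in _ = _ + X - _](_ : _ = #|[set X | P X & ~~ (v *m X <= U *m X)%MS]|%:R).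
  rewrite (_ : [set X in _ | _] = [set X | P X & (v *m X <= U *m X)%MS]); first by ring.
  by apply/setP=> X; rewrite !inE.
by congr (_%:R); apply: eq_card => X; rewrite !inE andbC.
Qed.

(** Induction on [c], adjoining to [U] one row [v] of [V]. As [P] sees only [U *m X], splitting by
    whether [v *m X] lies in [U *m X] yields the two terms of [ext_probSS] with codimension
    [a - r]. *)
Lemma card_extend c (U V : 'M[F]_m) (P : pred 'M[F]_(m, a)) r s :
    (U <= V)%MS -> \rank V = (\rank U + c)%N ->
    (forall X Y, U *m X = U *m Y -> P X = P Y) ->
    (forall X, P X -> \rank (U *m X) = r) ->
  #|[set X | P X & \rank (V *m X) == (r + s)%N]|%:R
    = #|[set X | P X]|%:R * ext_prob q c (a - r) s :> rat.
Proof.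
elim: c => [|c IHc] in U P r s *.
  move=> sUV rV PU Pr; rewrite ext_prob0S; last exact: inv_card_gt0.
  have eqUV : (U :=: V)%MS.
    by apply/eqmxP; rewrite -(mxrank_leqif_eq sUV) rV addn0.
  rewrite (_ : [set X | _ & _] = if s == 0%N then [set X | P X] else set0).
    by case: (s == 0%N); rewrite ?mulr1 ?cards0 ?mulr0.
  apply/setP=> X; rewrite [LHS]inE; case PX: (P X) => /=; last first.
    by case: ifP; rewrite inE ?PX.
  rewrite -(eqmxMr X eqUV) (Pr X PX) -{1}[r]addn0 eqn_add2l eq_sym.
  by case: (s == 0%N); rewrite inE ?PX.
move=> sUV rV PU Pr.
have [i vU] : exists i, ~~ (row i V <= U)%MS.
  by apply/row_subPn; apply: contraTN (leqnn (\rank V)) => /mxrankS; rewrite rV; lia.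
set v := row i V in vU; pose U1 := (U + v)%MS.
have sU1V : (U1 <= V)%MS by rewrite addsmx_sub sUV row_sub.
have rU1 : \rank U1 = (\rank U).+1 by exact: rank_adds_row.
have rV1 : \rank V = (\rank U1 + c)%N by rewrite rV rU1 addnS.
pose inU (X : 'M[F]_(m, a)) := (v *m X <= U *m X)%MS.
have U1U (X Y : 'M[F]_(m, a)) : U1 *m X = U1 *m Y -> U *m X = U *m Y /\ v *m X = v *m Y.
  by move=> E; split; [have /submxP[D ->] := addsmxSl U v
    | have /submxP[D ->] := addsmxSr U v]; rewrite -!mulmxA E.
have rin X : inU X -> \rank (U1 *m X) = \rank (U *m X).
  move=> inX; rewrite addsmxMr; apply: eqmx_rank.
  by rewrite addsmxSl addsmx_sub submx_refl (inX : is_true (_ <= _)%MS).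
have rout X : ~~ inU X -> \rank (U1 *m X) = (\rank (U *m X)).+1 by move=> inX;
  rewrite addsmxMr rank_adds_row.
pose P1 X := P X && inU X; pose P2 X := P X && ~~ inU X.
have [c1 c2] := card_extend_split vU PU Pr.
have IH1 := IHc U1 P1 r s sU1V rV1.
have {IH1} IH1 := IH1 _ _.
have IH2 t := IHc U1 P2 r.+1 t sU1V rV1.
have PU1 X Y : U1 *m X = U1 *m Y -> P1 X = P1 Y.
  by move=> /U1U[E1 E2]; rewrite /P1 /inU E1 E2 (PU _ _ E1).
have PU2 X Y : U1 *m X = U1 *m Y -> P2 X = P2 Y.
  by move=> /U1U[E1 E2]; rewrite /P2 /inU E1 E2 (PU _ _ E1).
have Pr1 X : P1 X -> \rank (U1 *m X) = r by case/andP=> /Pr <- /rin.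
have Pr2 X : P2 X -> \rank (U1 *m X) = r.+1 by case/andP=> /Pr <- /rout.
have -> : #|[set X | P X & \rank (V *m X) == (r + s)%N]| =
   (#|[set X | P1 X & \rank (V *m X) == (r + s)%N]| +
    #|[set X | P2 X & \rank (V *m X) == (r + s)%N]|)%N.
  rewrite -(cardsID [set X | inU X]); congr (_ + _)%N; apply: eq_card => X.
    by rewrite !inE /P1 andbAC.
  by rewrite !inE /P2 andbC andbAC.
rewrite natrD (IH1 PU1 Pr1) c1.
case: s => [|s] in IH1 *.
  (* For [s = 0] the second class is empty, since its rank on [U1] is already r + 1. *)
  rewrite (_ : [set X | P2 X & _] = set0) ?cards0 ?addr0; last first.
    apply/setP=> X; rewrite !inE; apply/negP=> /andP[/Pr2 rX /eqP].
    by have := mxrankS (submxMr X sU1V); rewrite rX addn0 => + E; rewrite E ltnn.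
  by rewrite ext_probS0 ?inv_card_gt0 //; ring.
by rewrite addnS -addSn (IH2 s PU2 Pr2) c2 ext_probSS ?inv_card_gt0 // subnS; ring.
Qed.

(** Here [d i] is the codimension of the image of [S i] under [X]: passing from [S i.+1] up to [S i]
    adds [c i] vectors and lowers it by [s i]. *)
Lemma card_chain L (S : nat -> 'M[F]_m) (c s d : nat -> nat) :
    (forall i, (S i.+1 <= S i)%MS) ->
    (forall i, \rank (S i) = (\rank (S i.+1) + c i)%N) -> S L = 0 ->
    d L = a -> (forall i, d i.+1 = (d i + s i)%N) ->
  #|[set X : 'M[F]_(m, a) |
       all (fun i => \rank (S i *m X) == (a - d i)%N) (index_iota 0 L)]|%:R
    = Q%:R ^+ (m * a) * \prod_(i < L) ext_prob q (c i) (d i.+1) (s i) :> rat.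
Proof.
move=> chS rS SL dL dS.
have subS i j : (i <= j)%N -> (S j <= S i)%MS.
  by move/subnK <-; elim: (j - i)%N => // k IHk; apply: submx_trans (chS _) IHk.
have d_homo i j : (i <= j)%N -> (d i <= d j)%N.
  by move/subnK <-; elim: (j - i)%N => // k IHk; rewrite addSn dS (leq_trans IHk) ?leq_addr.
pose P i (X : 'M[F]_(m, a)) := all (fun i => \rank (S i *m X) == (a - d i)%N) (index_iota i L).
(* Descending induction on [i]: [P i] keeps the rank conditions of index at least [i], which depend
   only on [S i *m X]. *)
suff IH k i : (k + i = L)%N -> #|[set X | P i X]|%:R
    = Q%:R ^+ (m * a) * \prod_(i <= j < L) ext_prob q (c j) (d j.+1) (s j) :> rat.
  by rewrite -(big_mkord xpredT (fun i => ext_prob q (c i) (d i.+1) (s i))) -(IH L) ?addn0.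
elim: k i => [|k IHk] i.
  rewrite add0n => ->; rewrite big_geq // mulr1 /P /index_iota subnn /= -natrX.
  by rewrite -card_mx; congr (_%:R); apply: eq_card => X; rewrite !inE.
rewrite addSnnS => kL; have lt_iL : (i < L)%N by lia.
rewrite big_ltn // mulrCA -(IHk i.+1 kL) mulrC.
have PE X : P i X = P i.+1 X && (\rank (S i *m X) == a - d i)%N.
  by rewrite /P /index_iota -(subnSK lt_iL) /= andbC.
have -> : d i.+1 = (a - (a - d i.+1))%N by rewrite subKn // -dL d_homo.
rewrite -(@card_extend (c i) (S i.+1) (S i) (P i.+1)) //.
- congr (_%:R); apply: eq_card => X; rewrite !inE PE; congr (_ && (_ == _)).
  by have := d_homo i.+1 L lt_iL; rewrite dL dS; lia.
- move=> X Y E; apply: eq_in_all => j; rewrite mem_index_iota => /andP[le_ij _].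
  by have /submxP[D ->] := subS _ _ le_ij; rewrite -!mulmxA E.
- move=> X PX; have [lt_i1|le_Li] := ltnP i.+1 L.
    by move/allP: PX => /(_ i.+1); rewrite mem_index_iota leqnn lt_i1 => /(_ isT)/eqP.
  have -> : i.+1 = L by lia.
  by rewrite SL mul0mx mxrank0 dL subnn.
Qed.

End Counting.

(** * Jordan type of a nilpotent matrix and of its extensions *)

Section Partitions.
Implicit Types s la : seq nat.
Local Open Scope nat_scope.

Lemma geq_trans : transitive geq.
Proof. by move=> x y z /= le_xy le_zx; apply: leq_trans le_zx le_xy. Qed.

(** In a decreasing sequence the zeros come last, and they agree with the default value read past
    the end. *)
Lemma nth_filter_pos s i : sorted geq s ->
  nth 0 [seq x <- s | 0 < x] i = nth 0 s i.
Proof.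
elim: s i => //= x s IHs i; rewrite (path_sortedE geq_trans) => /andP[/allP ub sort_s].
have [x0|x_le0] := ltnP 0 x; first by case: i => //= i; apply: IHs.
have z y : y \in x :: s -> y = 0.
  by rewrite inE => /predU1P[->|/ub /= le_yx]; lia.
rewrite (eq_in_filter (a2 := pred0)) => [|y ys]; last by rewrite (z y) // inE ys orbT.
rewrite filter_pred0 nth_nil.
have [lt_is|?] := ltnP i (size (x :: s)); last by rewrite nth_default.
by rewrite (z _ (mem_nth 0 lt_is)).
Qed.

Lemma part_inj s1 s2 : all (fun x => 0 < x) s1 -> all (fun x => 0 < x) s2 ->
  part s1 =1 part s2 -> s1 = s2.
Proof.
move=> /allP pos1 /allP pos2 E.
suff sz s s' : {in s, forall x, 0 < x} -> part s =1 part s' -> size s <= size s'.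
  apply: (@eq_from_nth _ 0) => [|i _]; last exact: E.
  by apply/eqP; rewrite eqn_leq !sz // => i; rewrite E.
move=> pos Es; rewrite leqNgt; apply/negP => lt_s.
by have := pos _ (mem_nth 0 lt_s); rewrite -[nth _ _ _]/(part s _) Es /part nth_default.
Qed.

Lemma part_ge s i : size s <= i -> part s i = 0.
Proof. exact: nth_default. Qed.

Lemma sum_part s L : size s <= L -> \sum_(i < L) part s i = sumn s.
Proof.
move=> le_sL; rewrite sumnE (big_nth 0) big_mkord -(subnKC le_sL) big_split_ord /=.
by rewrite [X in _ + X]big1 ?addn0 // => i _; rewrite /part nth_default ?leq_addr.
Qed.

Lemma size_le_sumn s : all (fun x => 0 < x) s -> size s <= sumn s.
Proof. by elim: s => //= x s IHs /andP[x0 /IHs]; lia. Qed.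

Lemma part_antimono s i j : sorted geq s -> i <= j -> part s j <= part s i.
Proof.
move=> sort_s le_ij; have [lt_js|?] := ltnP j (size s);
  last by rewrite /part (nth_default _ (n := j)).
apply: (sorted_leq_nth geq_trans _ 0 sort_s) => //; first exact: leqnn.
by rewrite inE (leq_ltn_trans le_ij).
Qed.

End Partitions.

(** The vectors of [A] killed by [row_mx N X] are those of [A :&: kermx N] killed by [X];
    rank-nullity for the three maps gives the formula. *)
Lemma rank_mul_row_mx (K : fieldType) k m p a
    (A : 'M[K]_(k, m)) (N : 'M[K]_(m, p)) (X : 'M[K]_(m, a)) :
  \rank (A *m row_mx N X) = (\rank (A *m N) + \rank ((A :&: kermx N)%MS *m X))%N.
Proof.
have E : \rank (A :&: kermx (row_mx N X))%MS = \rank (A :&: kermx N :&: kermx X)%MS.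
  apply: eqmx_rank; rewrite !sub_capmx !capmxSl !sub_kermx.
  set W := (A :&: kermx (row_mx _ _))%MS; set W' := (_ :&: kermx X)%MS.
  have : W *m row_mx N X == 0 by rewrite -sub_kermx capmxSr.
  rewrite mul_mx_row row_mx_eq0 => /andP[-> ->] /=.
  rewrite (submx_trans (capmxSl _ _) (capmxSl _ _)) /=.
  rewrite mul_mx_row row_mx_eq0 -!sub_kermx capmxSr andbT.
  exact: submx_trans (capmxSl _ _) (capmxSr _ _).
have := mxrank_mul_ker A (row_mx N X); have := mxrank_mul_ker A N.
have := mxrank_mul_ker (A :&: kermx N)%MS X; rewrite E; lia.
Qed.

Section JordanForm.
Variable F : finFieldType.

(** The space S_i of row vectors. For nilpotent [B] its rank is the part of index [i] of [JF B]. *)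
Definition jcore m (B : 'M[F]_m) i : 'M[F]_m := (B ^+ i :&: kermx B)%MS.

Lemma jcoreS m (B : 'M[F]_m) i : (jcore B i.+1 <= jcore B i)%MS.
Proof. by rewrite capmxS // exprS submxMl. Qed.

Lemma rank_jcore m (B : 'M[F]_m) i :
  (\rank (B ^+ i.+1) + \rank (jcore B i))%N = \rank (B ^+ i).
Proof. by rewrite exprSr; apply: mxrank_mul_ker. Qed.

Lemma rank_jcoreS m (B : 'M[F]_m) i : (\rank (jcore B i.+1) <= \rank (jcore B i))%N.
Proof. exact/mxrankS/jcoreS. Qed.

Lemma nilp_exp_ge m (B : 'M[F]_m) i : B ^+ m = 0 -> (m <= i)%N -> B ^+ i = 0.
Proof. by move=> B0 /subnK <-; rewrite exprD B0 mulr0. Qed.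

Lemma JF_pos m (B : 'M[F]_m) : all (fun x => (0 < x)%N) (JF B).
Proof. exact: filter_all. Qed.

Lemma JF_seqE m (B : 'M[F]_m) :
  JF B = [seq x <- [seq \rank (jcore B i) | i <- iota 0 m] | (0 < x)%N].
Proof.
rewrite /JF -[1%N]add1n iotaDl -map_comp; congr filter; apply: eq_map => i /=.
have := rank_jcore B i; have := rank_leq_row (B ^+ i).
by rewrite add1n /= ?add0n; lia.
Qed.

Lemma JF_seq_sorted m (B : 'M[F]_m) : sorted geq [seq \rank (jcore B i) | i <- iota 0 m].
Proof.
apply/(sortedP 0%N) => i; rewrite size_map size_iota => lt_im.
rewrite !(nth_map 0%N) ?size_iota ?nth_iota ?(ltnW lt_im) //.
exact: rank_jcoreS.
Qed.

Lemma JF_sorted m (B : 'M[F]_m) : sorted geq (JF B).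
Proof. by rewrite JF_seqE (sorted_filter geq_trans) ?JF_seq_sorted. Qed.

Lemma part_JF m (B : 'M[F]_m) i : B ^+ m = 0 -> part (JF B) i = \rank (jcore B i).
Proof.
move=> B0; rewrite /part JF_seqE nth_filter_pos ?JF_seq_sorted //.
have [lt_im|le_mi] := ltnP i m.
  by rewrite (nth_map 0%N) ?size_iota ?nth_iota.
rewrite nth_default ?size_map ?size_iota // /jcore nilp_exp_ge //.
by rewrite cap0mx mxrank0.
Qed.

Lemma sum_part_JF m (B : 'M[F]_m) i : B ^+ m = 0 ->
  (\rank (B ^+ i) + \sum_(j < i) part (JF B) j)%N = m.
Proof.
move=> B0; elim: i => [|i IHi]; first by rewrite big_ord0 addn0 expr0 mxrank1.
by rewrite big_ord_recr /= (part_JF _ B0) -[RHS]IHi -(rank_jcore B i) addnA addnAC.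
Qed.

Lemma size_JF m (B : 'M[F]_m) : (size (JF B) <= m)%N.
Proof.
by rewrite JF_seqE size_filter (leq_trans (count_size _ _)) // size_map size_iota.
Qed.

Lemma sumn_JF m (B : 'M[F]_m) : B ^+ m = 0 -> sumn (JF B) = m.
Proof.
move=> B0; rewrite -(sum_part (size_JF B)) -[RHS](sum_part_JF m B0).
by rewrite B0 mxrank0.
Qed.

(** The condition says that dim ker B^(i+1) is the sum of the first i+1 parts of [la]. Successive
    differences recover the parts; from index [m] on they vanish on both sides. *)
Lemma JF_eqP m (B : 'M[F]_m) la : B ^+ m = 0 -> is_partition m la ->
  reflect (forall i, (i < m)%N -> (\rank (B ^+ i.+1) + \sum_(j < i.+1) part la j)%N = m)
          (JF B == la).
Proof.
move=> B0 /and3P[_ pos_la /eqP sum_la]; apply: (iffP eqP) => [<- i _|E].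
  exact: sum_part_JF.
have size_la : (size la <= m)%N by rewrite -sum_la size_le_sumn.
apply: part_inj => //; first exact: JF_pos.
move=> i; rewrite part_JF //; have [lt_im|le_mi] := ltnP i m; last first.
  rewrite /part nth_default ?(leq_trans size_la) // /jcore nilp_exp_ge //.
  by rewrite cap0mx mxrank0.
have {}E k : (k <= m)%N -> (\rank (B ^+ k) + \sum_(j < k) part la j)%N = m.
  by case: k => [_|k /E//]; rewrite expr0 mxrank1 big_ord0 addn0.
have := rank_jcore B i; have := E i.+1 lt_im; have := E i (ltnW lt_im).
by rewrite big_ord_recr /=; lia.
Qed.

(** * Adjoining a block of columns to a nilpotent matrix *)

Section Extension.
Variables m a : nat.
Implicit Types (N : 'M[F]_m) (X : 'M[F]_(m, a)).

Definition ext_mx N X : 'M[F]_(m + a) := block_mx N X 0 0.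

Lemma ext_mx_exp N X i : ext_mx N X ^+ i.+1 = block_mx (N ^+ i.+1) (N ^+ i *m X) 0 0.
Proof.
elim: i => [|i IHi]; first by rewrite !expr1 expr0 mul1mx.
rewrite exprSr IHi /ext_mx -mulmxE mulmx_block !mulmx0 !mul0mx !addr0.
by rewrite !mulmxE -exprSr.
Qed.

Lemma rank_ext_mx_exp N X i :
  \rank (ext_mx N X ^+ i.+1) = (\rank (N ^+ i.+1) + \rank (jcore N i *m X))%N.
Proof.
have -> : \rank (ext_mx N X ^+ i.+1) = \rank (N ^+ i *m row_mx N X).
  by rewrite ext_mx_exp block_mxEv row_mx0 rank_col_mx0 mul_mx_row exprSr.
by rewrite rank_mul_row_mx exprSr.
Qed.

End Extension.

Lemma ext_mx_nilp m a (N : 'M[F]_m) (X : 'M[F]_(m, a)) :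
  N ^+ m = 0 -> ext_mx N X ^+ (m + a) = 0.
Proof.
move=> N0; have zN i : (m <= i)%N -> N ^+ i = 0 by exact: nilp_exp_ge.
suff E k : k = (m + a)%N -> ext_mx N X ^+ k = 0 by apply: E.
(* If [m + a = 0] the matrix is empty. Otherwise the exponent is k + 1, and the corner N^k X
   vanishes because [a = 0] or [k >= m]. *)
case: k => [|k] Ek; first by apply/matrixP => i; have := ltn_ord i; lia.
rewrite ext_mx_exp zN ?Ek ?leq_addr //.
suff -> : N ^+ k *m X = 0 by rewrite block_mx0.
have [a0|a_gt0] := posnP a; first by apply/matrixP => i j; have := ltn_ord j; lia.
by rewrite zN ?mul0mx //; lia.
Qed.

(** By the rank formula for powers, the extension has type [la] exactly when each [jcore N i *m X]
    has rank [a - strips i]. This is the situation of [card_chain] for the chain of the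
    [jcore N i]. *)
Lemma card_ext_JF m a (N : 'M[F]_m) (la : seq nat) :
    let q : rat := #|F|%:R^-1 in
    let mu := part (JF N) in
    let strip i := (part la i - mu i)%N in
    let strips i := (\sum_(j < i.+1) strip j)%N in
    N ^+ m = 0 -> is_partition (m + a) la -> (forall i, mu i <= part la i)%N ->
  #|[set X : 'M[F]_(m, a) | JF (ext_mx N X) == la]|%:R =
    #|F|%:R ^+ (m * a) *
    \prod_(i < m + a) ext_prob q (mu i - mu i.+1) (strips i.+1) (strip i.+1).
Proof.
move=> q mu strip strips N0 la_part le_mu_la.
have [_ la_pos /eqP la_sum] := and3P la_part.
have size_la : (size la <= m + a)%N by rewrite -la_sum size_le_sumn.
have sumE i : (\sum_(j < i) part la j = \sum_(j < i) mu j + \sum_(j < i) strip j)%N.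
  by rewrite -big_split; apply: eq_bigr => j _; rewrite /= subnKC.
have sum_strip i : (m + a <= i)%N -> (\sum_(j < i) strip j = a)%N.
  move=> le_i; have := sumE i.
  rewrite !sum_part ?(leq_trans (size_JF N)) ?(leq_trans size_la) ?sumn_JF ?la_sum //; lia.
(* This bound keeps [a - strips i] from being truncated. *)
have strips_le i : (strips i <= a)%N.
  rewrite -(sum_strip (i.+1 + (m + a))%N) ?leq_addl // big_split_ord /=.
  exact: leq_addr.
apply: etrans _ (@card_chain F m a (m + a) (jcore N) (fun i => mu i - mu i.+1)%N
  (fun i => strip i.+1) strips _ _ _ _ _).
- congr (_%:R); apply: eq_card => X; rewrite !inE.
  apply/(JF_eqP (ext_mx_nilp X N0) la_part)/allP => [E i|E i lt_i].
    rewrite mem_index_iota => /= lt_i; have := E i lt_i.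
    rewrite rank_ext_mx_exp sumE; have := sum_part_JF i.+1 N0; rewrite -/(strips i) -/mu.
    by have := strips_le i; lia.
  have := E i; rewrite mem_index_iota lt_i => /(_ isT)/eqP.
  rewrite rank_ext_mx_exp sumE; have := sum_part_JF i.+1 N0; rewrite -/(strips i) -/mu.
  by have := strips_le i; lia.
- exact: jcoreS.
- by move=> i; rewrite /mu !part_JF // subnKC ?rank_jcoreS.
- by rewrite /jcore (nilp_exp_ge N0) ?leq_addr // cap0mx.
- exact: sum_strip.
- by move=> i; rewrite /strips big_ord_recr.
Qed.

End JordanForm.

(** * Strictly block upper triangular matrices *)

(** The interlacing form of the condition that la/mu has at most one box per column. *)
Definition horizontal_strip (la mu : seq nat) : Prop :=
  forall i, (part mu i <= part la i)%N /\ (part la i.+1 <= part mu i)%N.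

Definition strip_chain (al : seq nat) (sh : nat -> seq nat) : Prop :=
  (forall j, (j <= size al)%N -> is_partition (sumn (take j al)) (sh j)) /\
  (forall j, (j < size al)%N -> horizontal_strip (sh j.+1) (sh j)).

(** The factor of [wt] for one index j, with [mu] and [la] the shapes of the entries up to j-1 and
    up to j. *)
Definition strip_wt (q : rat) (la mu : seq nat) : rat :=
  \prod_(i < size la) qbinom q (part la i - part la i.+1) (part la i - part mu i).

Lemma take_rcons_le (al : seq nat) a j : (j <= size al)%N -> take j (rcons al a) = take j al.
Proof. by move=> le_j; rewrite -cats1 takel_cat. Qed.

Lemma take_rcons_size (al : seq nat) a : take (size al).+1 (rcons al a) = rcons al a.
Proof. by rewrite take_oversize // size_rcons. Qed.

Lemma sumn_take_le (al : seq nat) j : (sumn (take j al) <= sumn al)%N.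
Proof. by rewrite -{2}(cat_take_drop j al) sumn_cat leq_addr. Qed.

Lemma strip_chain_rcons al a sh : strip_chain (rcons al a) sh ->
  [/\ strip_chain al sh, is_partition (sumn al + a) (sh (size al).+1) &
      horizontal_strip (sh (size al).+1) (sh (size al))].
Proof.
case; rewrite size_rcons => part_sh strip_sh; split; first split.
- by move=> j le_j; rewrite -(take_rcons_le a le_j); apply: part_sh; apply: leqW.
- by move=> j lt_j; apply: strip_sh; apply: leqW.
- by have := part_sh _ (leqnn _); rewrite take_rcons_size sumn_rcons.
- exact: strip_sh.
Qed.

Section Blocks.
Implicit Type al : seq nat.

Lemma in_block_size al i r : in_block al i r -> (i < size al)%N.
Proof.
case/andP=> le_r lt_r; rewrite ltnNge; apply/negP => le_i.
by move: lt_r; rewrite ltnNge !take_oversize // in le_r *; rewrite ?le_r //; lia.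
Qed.

Lemma in_block_ub al i r : in_block al i r -> (r < sumn al)%N.
Proof. by case/andP=> _ lt_r; apply: leq_trans lt_r (sumn_take_le _ _). Qed.

Lemma in_block_rcons al a i r : (i < size al)%N ->
  in_block (rcons al a) i r = in_block al i r.
Proof. by move=> lt_i; rewrite /in_block !take_rcons_le // ltnW. Qed.

Lemma in_block_last al a r :
  in_block (rcons al a) (size al) r = (sumn al <= r < sumn al + a)%N.
Proof.
by rewrite /in_block take_rcons_size sumn_rcons take_rcons_le // take_size.
Qed.

Lemma in_block_ex al r : (r < sumn al)%N -> exists i, in_block al i r.
Proof.
elim/last_ind: al => [|al a IHal] //; rewrite sumn_rcons => lt_r.
have [/IHal[i iP]|le_r] := ltnP r (sumn al).
  by exists i; rewrite in_block_rcons // (in_block_size iP).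
by exists (size al); rewrite in_block_last le_r.
Qed.

Variable F : finFieldType.

Lemma in_nalphaP n al (N : 'M[F]_n) :
  reflect (forall i j (r s : 'I_n), in_block al i r -> in_block al j s -> (j <= i)%N ->
             N r s = 0)
          (in_nalpha al N).
Proof.
apply: (iffP idP) => [Nal i j r s ir js le_ji | Nal].
  move/forallP: Nal => /(_ (Ordinal (in_block_size ir)))/forallP.
  move=> /(_ (Ordinal (in_block_size js)))/forallP/(_ r)/forallP/(_ s)/implyP.
  by rewrite /= ir js le_ji => /(_ isT)/eqP.
do 4!apply/forallP => ?; apply/implyP => /andP[/andP[ir js] le_ji].
by apply/eqP; apply: Nal ir js le_ji.
Qed.

(** The rows of the last block are already zero, and its columns are unconstrained in the rows
    above, so [X] is free. *)
Lemma in_nalpha_ext m a al (N : 'M[F]_m) (X : 'M[F]_(m, a)) : sumn al = m ->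
  in_nalpha (rcons al a) (ext_mx N X) = in_nalpha al N.
Proof.
move=> Hm; apply/in_nalphaP/in_nalphaP => Nal i j r s ir js le_ji.
  have := Nal i j (lshift a r) (lshift a s); rewrite /= !in_block_rcons ?(in_block_size ir)
    ?(in_block_size js) //.
  by rewrite block_mxEul; apply.
rewrite /ext_mx; case: (split_ordP r) ir => r' ->; last first.
  by case: (split_ordP s) => s' ->; rewrite ?block_mxEdl ?block_mxEdr mxE.
move=> ir; have lt_i : (i < size al)%N.
  have := in_block_size ir; rewrite size_rcons ltnS leq_eqVlt => /orP[/eqP Ei|//].
  by move: ir; rewrite Ei in_block_last Hm /= leqNgt ltn_ord.
move: ir js; rewrite !in_block_rcons // ?(leq_ltn_trans le_ji) //= => ir js.
case: (split_ordP s) js => s' -> /= js; first by rewrite block_mxEul (Nal i j).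
by have := in_block_ub js; rewrite Hm ltnNge leq_addr.
Qed.

(** The last block has the largest index, which forces every entry in its rows to vanish. *)
Lemma nalpha_ext_mx m a al (N : 'M[F]_(m + a)) : sumn al = m ->
  in_nalpha (rcons al a) N -> N = ext_mx (ulsubmx N) (ursubmx N).
Proof.
move=> Hm /in_nalphaP Nal.
have dN (r : 'I_a) s : N (rshift m r) s = 0.
  have [j js] : exists j, in_block (rcons al a) j s.
    by apply: in_block_ex; rewrite sumn_rcons Hm.
  apply: (Nal (size al) j _ _ _ js);
    first by rewrite in_block_last Hm /= leq_addr ltn_add2l ltn_ord.
  by have := in_block_size js; rewrite size_rcons.
rewrite -[LHS]submxK /ext_mx; congr block_mx; apply/matrixP => r s; rewrite !mxE dN //.
Qed.

Lemma topleft_id n (A : 'M[F]_n) : topleft n A = A.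
Proof. by apply/matrixP => r s; rewrite mxE /mx_nat !valK. Qed.

Lemma topleft_ext m a k (N : 'M[F]_m) (X : 'M[F]_(m, a)) : (k <= m)%N ->
  topleft k (ext_mx N X) = topleft k N.
Proof.
move=> le_km; apply/matrixP => r s; rewrite !mxE /mx_nat.
have w (i : 'I_k) : insub (val i) = Some (lshift a (widen_ord le_km i)).
  rewrite insubT ?(leq_trans (ltn_ord i)) ?(leq_trans le_km) ?leq_addr // => lt.
  by congr Some; apply: val_inj.
have v (i : 'I_k) : insub (val i) = Some (widen_ord le_km i).
  by rewrite insubT ?(leq_trans (ltn_ord i)) // => lt; congr Some; apply: val_inj.
by rewrite !w !v block_mxEul.
Qed.

Lemma JF_sh_ext m a al (N : 'M[F]_m) (X : 'M[F]_(m, a)) j :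
  sumn al = m -> (j <= size al)%N -> JF_sh (rcons al a) (ext_mx N X) j = JF_sh al N j.
Proof.
move=> Hm le_j; rewrite /JF_sh take_rcons_le // topleft_ext //.
by rewrite -Hm sumn_take_le.
Qed.

Lemma JF_sh_last n al (N : 'M[F]_n) : sumn al = n -> JF_sh al N (size al) = JF N.
Proof. by move=> Hn; subst n; rewrite /JF_sh take_size topleft_id. Qed.

Lemma nalpha_nilp n al (N : 'M[F]_n) : sumn al = n -> in_nalpha al N -> N ^+ n = 0.
Proof.
elim/last_ind: al n N => [|al a IHal] n N; first by move=> /= Hn; subst n => _; apply: flatmx0.
rewrite sumn_rcons => Hn; subst n => Nal; rewrite (nalpha_ext_mx (erefl _) Nal).
apply/ext_mx_nilp/IHal => //; rewrite -(in_nalpha_ext _ (ursubmx N) (erefl _)).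
by rewrite -(nalpha_ext_mx (erefl _) Nal).
Qed.

Lemma JF_partition n (N : 'M[F]_n) : N ^+ n = 0 -> is_partition n (JF N).
Proof.
by move=> N0; rewrite /is_partition JF_sorted JF_pos sumn_JF // eqxx.
Qed.

(** Let S_i and S'_i be the [jcore] spaces of [N] and of the extension. Then dim S'_(i+1) = dim
    S_(i+1) + rank(S_i X) - rank(S_(i+1) X), and S_(i+1) X lies in S_i X, which gives containment.
    The right side is also dim(S_(i+1) :&: ker X) + rank(S_i X), hence at most dim S_i. *)
Lemma ext_mx_strip m a (N : 'M[F]_m) (X : 'M[F]_(m, a)) : N ^+ m = 0 ->
  horizontal_strip (JF (ext_mx N X)) (JF N).
Proof.
move=> N0 i; rewrite !part_JF ?ext_mx_nilp //.
have rS k : (\rank (jcore (ext_mx N X) k.+1) + \rank (jcore N k.+1 *m X) =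
             \rank (jcore N k.+1) + \rank (jcore N k *m X))%N.
  have := rank_jcore (ext_mx N X) k.+1; have := rank_jcore N k.+1.
  rewrite !rank_ext_mx_exp; lia.
split.
  case: i => [|i].
    have := rank_jcore (ext_mx N X) 0; have := rank_jcore N 0.
    rewrite rank_ext_mx_exp !expr0 !mxrank1; have := rank_leq_col (jcore N 0 *m X); lia.
  have le : (\rank (jcore N i.+1 *m X) <= \rank (jcore N i *m X))%N.
    exact/mxrankS/submxMr/jcoreS.
  by rewrite -(leq_add2r (\rank (jcore N i.+1 *m X))) rS leq_add2l.
have le : (\rank (jcore N i.+1 :&: kermx X)%MS <= \rank (jcore N i :&: kermx X)%MS)%N.
  by apply/mxrankS/capmxS; first exact: jcoreS.
rewrite -(leq_add2r (\rank (jcore N i.+1 *m X))) rS -{1}(mxrank_mul_ker (jcore N i.+1) X).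
rewrite -(mxrank_mul_ker (jcore N i) X) addnAC [leqRHS]addnAC.
by rewrite [X in (_ <= X + _)%N]addnC leq_add2l.
Qed.

(** Induction on the number of blocks: the earlier flag spaces only see [ulsubmx N], and the last
    step is [ext_mx_strip]. *)
Lemma nalpha_strip_chain n al (N : 'M[F]_n) : sumn al = n -> in_nalpha al N ->
  strip_chain al (JF_sh al N).
Proof.
elim/last_ind: al n N => [|al a IHal] n N.
  by move=> /= Hn; subst n => _; split=> // -[|j] // _; rewrite /JF_sh /= /JF.
rewrite sumn_rcons => Hn; subst n => Nal; move: (Nal).
rewrite (nalpha_ext_mx (erefl _) Nal) in_nalpha_ext //.
set N' := ulsubmx N; set X := ursubmx N => Nal'.
have N0 := nalpha_nilp (erefl _) Nal'.
have shE j : (j <= size al)%N -> JF_sh (rcons al a) (ext_mx N' X) j = JF_sh al N' j.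
  exact: JF_sh_ext.
have shL : JF_sh (rcons al a) (ext_mx N' X) (size al).+1 = JF (ext_mx N' X).
  by rewrite -[(size al).+1](size_rcons al a) JF_sh_last // sumn_rcons.
have [IHp IHs] := IHal _ _ (erefl _) Nal'.
split=> j; rewrite size_rcons.
  rewrite leq_eqVlt => /orP[/eqP->|]; last first.
    by rewrite ltnS => le_j; rewrite shE // take_rcons_le // IHp.
  by rewrite shL take_rcons_size sumn_rcons JF_partition // ext_mx_nilp.
rewrite ltnS leq_eqVlt => /orP[/eqP->|lt_j]; last by rewrite (shE j.+1) ?(shE j (ltnW lt_j)) //;
  apply: IHs.
by rewrite shL shE // JF_sh_last //; apply: ext_mx_strip.
Qed.

End Blocks.

(** * Counting matrices with a prescribed chain of shapes *)

(** Serves to bring products and sums over partitions of different lengths to a common range. *)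
Lemma big_ord_widen_idx (R : Type) (idx : R) (op : Monoid.law idx) k L (f : nat -> R) :
  (k <= L)%N -> (forall i, (k <= i)%N -> f i = idx) ->
  \big[op/idx]_(i < L) f i = \big[op/idx]_(i < k) f i.
Proof.
move=> le_kL f1; rewrite -(subnKC le_kL) big_split_ord /=.
by rewrite [X in op _ X]big1 ?Monoid.mulm1 // => i _; rewrite f1 ?leq_addr.
Qed.

Lemma strip_wtE q la mu L : 0 < q -> horizontal_strip la mu -> (size la <= L)%N ->
  strip_wt q la mu =
  \prod_(i < L) qbinom q (part la i - part la i.+1) (part la i - part mu i).
Proof.
move=> q_gt0 lamu le_L; rewrite /strip_wt.
rewrite (@big_ord_widen_idx _ _ _ _ L (fun i => qbinom q (part la i - part la i.+1)
  (part la i - part mu i)) le_L) //.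
by move=> i le_i; rewrite part_ge // qbinom0.
Qed.

Lemma prod_qfact_part q la L : (size la <= L)%N ->
  \prod_(0 <= i < size la) qfact q (part la i - part la i.+1) =
  \prod_(i < L) qfact q (part la i - part la i.+1).
Proof.
move=> le_L; rewrite big_mkord.
rewrite (@big_ord_widen_idx _ _ _ _ L (fun i => qfact q (part la i - part la i.+1)) le_L) //.
by move=> i le_i; rewrite part_ge // qfact0.
Qed.

Lemma nlam_part la L : (size la <= L)%N -> nlam la = (\sum_(i < L) 'C(part la i, 2))%N.
Proof.
move=> le_L; rewrite /nlam (big_nth 0%N) big_mkord.
rewrite (@big_ord_widen_idx _ _ _ _ L (fun i => 'C(part la i, 2)) le_L) //.
by move=> i le_i; rewrite part_ge.
Qed.

Lemma size_partition n la : is_partition n la -> (size la <= n)%N.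
Proof. by case/and3P=> _ pos /eqP <-; apply: size_le_sumn. Qed.

Lemma expfzB_nat (x : rat) (a b : nat) : x != 0 -> x ^ (a%:Z - b%:Z) = x ^+ a / x ^+ b.
Proof. by move=> x0; rewrite expfzDr // -exprnN. Qed.

Section PrefactorStep.
Variables (q : rat) (m a : nat) (al la mu : seq nat).
Hypotheses (q_gt0 : 0 < q) (q_neq1 : q != 1).
Hypotheses (mu_part : is_partition m mu) (la_part : is_partition (m + a) la).
Hypothesis lamu : horizontal_strip la mu.

(** The factor multiplying the prefactor of [la] is, for [q] the inverse of the field size, the
    number of [X] extending a matrix of type [mu] to type [la]. The power of q in it is absorbed by
    C(m+a,2) = C(m,2) + C(a,2) + ma, the change of n(la) by [strips_binomial_sum], and the rest by
    [prod_ext_prob]. *)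
Lemma prefactor_step :
  let strip i := (part la i - part mu i)%N in
  let strips i := (\sum_(j < i.+1) strip j)%N in
  prefactor q (m + a) la (rcons al a) * (q^-1 ^+ (m * a) *
    \prod_(i < m + a) ext_prob q (part mu i - part mu i.+1) (strips i.+1) (strip i.+1))
  = prefactor q m mu al * strip_wt q la mu.
Proof.
move=> strip strips.
have le_mu_la i : (part mu i <= part la i)%N by have [] := lamu i.
have le_la_mu i : (part la i.+1 <= part mu i)%N by have [] := lamu i.
have size_la := size_partition la_part.
have size_mu : (size mu <= m + a)%N by rewrite (leq_trans (size_partition mu_part)) ?leq_addr.
have sum_strips : strips (m + a)%N = a.
  have : (\sum_(j < (m + a).+1) part la j =
          \sum_(j < (m + a).+1) part mu j + strips (m + a))%N.
    by rewrite /strips -big_split; apply: eq_bigr => j _; rewrite /= subnKC.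
  rewrite !sum_part ?leqW //; case/and3P: la_part => _ _ /eqP->.
  by case/and3P: mu_part => _ _ /eqP-> /eqP; rewrite eqn_add2l => /eqP.
have strip0 : strip (m + a)%N = 0%N by rewrite /strip part_ge.
have EG : (\prod_(i < m + a) ext_prob q (part mu i - part mu i.+1) (strips i.+1) (strip i.+1)) *
  (\prod_(i < m + a) qfact q (part la i - part la i.+1)) * (1 - q) ^+ strip 0
  = (\prod_(i < m + a) qfact q (part mu i - part mu i.+1)) *
    (\prod_(i < m + a) qbinom q (part la i - part la i.+1) (strip i)) *
    q ^+ (\sum_(i < m + a) strips i * (part mu i - part la i.+1)) * ((1 - q) ^+ a * qfact q a).
  exact: prod_ext_prob.
have EN : nlam la = (nlam mu + 'C(a, 2) +
    \sum_(i < m + a) strips i * (part mu i - part la i.+1))%N.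
  rewrite (nlam_part (leqW size_la)) (nlam_part (leqW size_mu)).
  have := strips_binomial_sum le_mu_la le_la_mu (m + a).
  by rewrite -/(strips (m + a)%N) sum_strips (part_ge size_mu) muln0 addn0.
rewrite /prefactor (prod_qfact_part q size_la) (prod_qfact_part q size_mu).
rewrite (strip_wtE q_gt0 lamu size_la) -/(strip _).
have q0 : q != 0 by rewrite gt_eqF.
have q1 : 1 - q != 0 by rewrite subr_eq0 eq_sym.
have CE : \prod_(i <- rcons al a) qfact q i = (\prod_(i <- al) qfact q i) * qfact q a.
  by rewrite big_rcons.
rewrite !expfzB_nat // CE.
rewrite EN; move: EG.
set G := \prod_(i < m + a) ext_prob _ _ _ _; set A := \prod_(i < m + a) qfact q (part la i - _).
set B := \prod_(i < m + a) qfact q (part mu i - _).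
set W := \prod_(i < m + a) qbinom _ _ _; set e := (\sum_(i < m + a) _)%N.
set C := \prod_(i <- al) _.
move=> EG; rewrite bin2D.
have la0 : part la 0 = (part mu 0 + strip 0)%N by rewrite /strip subnKC.
have C0 : C != 0 by rewrite /C prodf_seq_neq0; apply/allP => i _; apply: qfact_neq0.
have fa0 := qfact_neq0 q_gt0 a.
rewrite la0 !exprD exprVn.
(* Isolates the left side of [EG] after cancelling q^(ma) against its inverse. *)
rewrite [LHS](_ : _ = q ^+ 'C(m, 2) * q ^+ 'C(a, 2) / (q ^+ nlam mu * q ^+ 'C(a, 2) * q ^+ e)
  * ((1 - q) ^+ part mu 0 / ((1 - q) ^+ m * (1 - q) ^+ a)) / (C * qfact q a) *
  (G * A * (1 - q) ^+ strip 0)); last first.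
  have h1 : q ^+ (m * a) != 0 by rewrite expf_neq0.
  have h2 : q ^+ nlam mu != 0 by rewrite expf_neq0.
  have h3 : q ^+ 'C(a, 2) != 0 by rewrite expf_neq0.
  have h4 : q ^+ e != 0 by rewrite expf_neq0.
  have h5 : (1 - q) ^+ m != 0 by rewrite expf_neq0.
  have h6 : (1 - q) ^+ a != 0 by rewrite expf_neq0.
  move: (q ^+ _) (q ^+ _) (q ^+ _) (q ^+ _) (q ^+ _) h1 h2 h3 h4.
  move: ((1 - q) ^+ _) ((1 - q) ^+ _) ((1 - q) ^+ _) ((1 - q) ^+ _) h5 h6.
  move=> *; field; by do ?[apply/andP; split].
rewrite EG.
have h2 : q ^+ nlam mu != 0 by rewrite expf_neq0.
have h3 : q ^+ 'C(a, 2) != 0 by rewrite expf_neq0.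
have h4 : q ^+ e != 0 by rewrite expf_neq0.
have h5 : (1 - q) ^+ m != 0 by rewrite expf_neq0.
have h6 : (1 - q) ^+ a != 0 by rewrite expf_neq0.
move: ((1 - q) ^+ m) ((1 - q) ^+ a) ((1 - q) ^+ part mu 0) h5 h6.
move: (q ^+ nlam mu) (q ^+ 'C(a, 2)) (q ^+ e) (q ^+ 'C(m, 2)) h2 h3 h4.
move=> *; field; by do ?[apply/andP; split].
Qed.

End PrefactorStep.

Lemma card_dep_pairs (S T : finType) (A : {set S}) (P : S -> pred T) :
  #|[set p : S * T | p.1 \in A & P p.1 p.2]| = (\sum_(x in A) #|[set y | P x y]|)%N.
Proof.
rewrite -sum1_card (eq_bigr (fun x => \sum_(y in [set y | P x y]) 1)%N).
  by rewrite pair_big_dep; apply: eq_bigl => p; rewrite !inE.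
by move=> x _; rewrite sum1_card.
Qed.

Section Chains.
Variable F : finFieldType.
Let q : rat := #|F|%:R^-1.

Lemma inv_card_neq1 : q != 1.
Proof.
rewrite invr_eq1 -[1]/(1%:R) eqr_nat gtn_eqF //.
exact: card_finNzRing_gt1.
Qed.

(** The tableau is replaced by its chain of shapes, whose last member can be split off in an
    induction on [al]. *)
Definition chain_mx n (al : seq nat) (sh : nat -> seq nat) : {set 'M[F]_n} :=
  [set N : 'M[F]_n | in_nalpha al N &
     all (fun j => JF_sh al N j == sh j) (iota 0 (size al).+1)].

Lemma chain_mx_rcons m a al sh : sumn al = m ->
  chain_mx (m + a) (rcons al a) sh =
  (fun p => ext_mx p.1 p.2) @: [set p : 'M[F]_m * 'M[F]_(m, a) |
    p.1 \in chain_mx m al sh & JF (ext_mx p.1 p.2) == sh (size al).+1].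
Proof.
move=> Hm.
have E (N : 'M[F]_m) (X : 'M[F]_(m, a)) : (ext_mx N X \in chain_mx (m + a) (rcons al a) sh) =
    (N \in chain_mx m al sh) && (JF (ext_mx N X) == sh (size al).+1).
  rewrite !inE in_nalpha_ext // -andbA; congr (_ && _).
  have -> : iota 0 (size (rcons al a)).+1 = rcons (iota 0 (size al).+1) (size al).+1.
    by rewrite size_rcons -(addn1 (size al).+1) iotaD cats1.
  rewrite all_rcons andbC; congr (_ && _); last first.
    by rewrite -(size_rcons al a) JF_sh_last // sumn_rcons Hm.
  by apply: eq_in_all => j; rewrite mem_iota add0n ltnS => lt_j; rewrite JF_sh_ext.
apply/setP=> N; apply/idP/imsetP => [Nch | [[N' X] /=]].
  have Nal : in_nalpha (rcons al a) N by move: Nch; rewrite inE => /andP[].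
  have Ne := nalpha_ext_mx Hm Nal.
  exists (ulsubmx N, ursubmx N) => //.
  by rewrite in_set /= -E -Ne.
by rewrite in_set /= -E => NX ->.
Qed.

(** Induction on [al], where each new block multiplies both sides by one strip weight through
    [prefactor_step]. *)
Lemma card_chain_mx n al sh : sumn al = n -> strip_chain al sh ->
  prefactor q n (sh (size al)) al * #|chain_mx n al sh|%:R =
  \prod_(j < size al) strip_wt q (sh j.+1) (sh j).
Proof.
elim/last_ind: al n => [|al a IHal] n.
  move=> /= Hn; subst n => -[/(_ 0%N (leqnn _)) sh0 _].
  have sh0E : sh 0%N = [::].
    case: (sh 0%N) sh0 => // x s /and3P[_ /= /andP[x0 _]]; lia.
  have -> : chain_mx 0 [::] sh = setT.
    apply/setP=> N; rewrite !inE.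
    apply/andP; split; first by apply/forallP => -[].
    by rewrite /= andbT sh0E.
  rewrite sh0E cardsT card_mx muln0 expn0 /prefactor /nlam !big_nil big_ord0.
  by rewrite //= !subrr !expr0z !mulr1 invr1.
rewrite sumn_rcons => Hn; subst n => /strip_chain_rcons[sh_chain sh_part sh_strip].
have IH := IHal _ (erefl _) sh_chain.
rewrite size_rcons big_ord_recr /= -IH (chain_mx_rcons _ _ (erefl _)).
rewrite card_imset; last first.
  by move=> [N X] [N' X'] /= /eq_block_mx[-> ->].
rewrite (card_dep_pairs (chain_mx (sumn al) al sh)
  (fun N (X : 'M[F]_(sumn al, a)) => JF (ext_mx N X) == sh (size al).+1)).
have [sh_p _] := sh_chain; have := sh_p _ (leqnn _); rewrite take_size => mu_part.
have shS N : N \in chain_mx (sumn al) al sh ->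
    in_nalpha al N /\ JF N = sh (size al).
  rewrite inE => /andP[Nal /allP/(_ (size al))]; rewrite mem_iota leqnn => /(_ isT)/eqP <-.
  by rewrite JF_sh_last.
(* The number of extensions [X] depends on [N] only through its Jordan type, so all summands are
   equal. *)
rewrite natr_sum (eq_bigr (fun=> q^-1 ^+ (sumn al * a) *
    \prod_(i < sumn al + a) ext_prob q (part (sh (size al)) i - part (sh (size al)) i.+1)
      (\sum_(j < i.+2) (part (sh (size al).+1) j - part (sh (size al)) j))
      (part (sh (size al).+1) i.+1 - part (sh (size al)) i.+1))); last first.
  move=> N /shS[Nal EN]; rewrite -EN invrK.
  apply: card_ext_JF => //; first exact: nalpha_nilp Nal.
  by move=> i; rewrite EN; have [] := sh_strip i.
have PS := prefactor_step al (inv_card_gt0 F) inv_card_neq1 mu_part sh_part sh_strip.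
rewrite sumr_const -[X in _ * X = _]mulr_natr mulrA [RHS]mulrAC; congr (_ * _).
exact: PS.
Qed.

End Chains.

(** * Tableaux as chains of horizontal strips *)

Section Tableaux.
Local Open Scope nat_scope.
Implicit Types (T : tableau) (al la : seq nat).

Definition count_le (j : nat) (r : seq nat) : nat := count (fun e => e <= j) r.

Lemma count_leS j r : count_le j.+1 r = count_le j r + count_mem j.+1 r.
Proof.
rewrite /count_le; elim: r => //= e r ->; rewrite (leq_eqVlt e) ltnS.
by case: eqP => [->|_] /=; [rewrite ltnn | ]; lia.
Qed.

Lemma count_le_mono j k r : j <= k -> count_le j r <= count_le k r.
Proof. by move=> le_jk; apply: sub_count => e /= /leq_trans; apply. Qed.

Lemma count_le_oversize j r : {in r, forall e, e <= j} -> count_le j r = size r.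
Proof. by move=> r_j; apply/eqP; rewrite -all_count; apply/allP. Qed.

(** In a sorted row the entries at most [j] form an initial segment. *)
Lemma nth_le_count j c r : sorted leq r -> c < size r ->
  (nth 0 r c <= j) = (c < count_le j r).
Proof.
rewrite /count_le; elim: r c => // e r IHr c r_sort lt_c.
have r_sort' := path_sorted r_sort.
have /allP e_min := order_path_min leq_trans r_sort.
rewrite [count _ _]/=; have [le_ej|lt_je] := leqP e j.
  by case: c lt_c => [|c] //= lt_c; rewrite add1n ltnS IHr.
have gt_j x : x \in e :: r -> j < x.
  by rewrite inE => /predU1P[->|/e_min]; last apply: leq_trans.
rewrite (eq_in_count (a2 := pred0)) => [|x r_x]; last first.
  by apply/negbTE; rewrite -ltnNge gt_j // inE r_x orbT.
by rewrite count_pred0 ltn0; apply/negbTE; rewrite -ltnNge gt_j ?mem_nth.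
Qed.

Lemma sumn_take_S (s : seq nat) j : sumn (take j.+1 s) = sumn (take j s) + nth 0 s j.
Proof.
have [lt_j|le_j] := ltnP j (size s); first by rewrite (take_nth 0) // sumn_rcons.
by rewrite nth_default // !take_oversize ?addn0 // leqW.
Qed.

Lemma sumn_shape_le j T : sumn (shape_le j T) = count_le j (flatten T).
Proof.
rewrite /count_le count_flatten /shape_le.
by elim: [seq _ | r <- T] => //= x s <-; case: ltnP => //= x0; rewrite (_ : x = 0) //; lia.
Qed.

Section ColumnCounts.
Variables (j : nat) (T : tableau).
Hypothesis count_anti : forall i,
  count_le j (nth [::] T i.+1) <= count_le j (nth [::] T i).

Let counts := [seq count_le j r | r <- T].

Let nth_counts i : nth 0 counts i = count_le j (nth [::] T i).
Proof.
have [lt_i|le_i] := ltnP i (size T); first by rewrite (nth_map [::]).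
by rewrite !nth_default ?size_map.
Qed.

Let counts_sorted : sorted geq counts.
Proof. by apply/(sortedP 0) => i _; rewrite !nth_counts; apply: count_anti. Qed.

Lemma shape_le_sorted : sorted geq (shape_le j T).
Proof. exact: sorted_filter geq_trans _ _ counts_sorted. Qed.

Lemma part_shape_le i : part (shape_le j T) i = count_le j (nth [::] T i).
Proof. by rewrite /part nth_filter_pos ?nth_counts //. Qed.

End ColumnCounts.

Lemma shape_le_pos j T : all (fun x => 0 < x) (shape_le j T).
Proof. exact: filter_all. Qed.

(** * From semistandard tableaux to chains of shapes *)

Section Semistandard.
Variables (n : nat) (al la : seq nat) (T : tableau).
Hypotheses (la_part : is_partition n la) (T_ssyt : is_ssyt_shape la T).

Let sizeT i : size (nth [::] T i) = part la i.
Proof.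
have [<- _ _] := T_ssyt; rewrite /part /Defs.shape.
have [lt_i|le_i] := ltnP i (size T); first by rewrite (nth_map [::]).
by rewrite !nth_default ?size_map.
Qed.

(** Above the last entry counted on the left, in column [c], stands an entry smaller than [j] by
    column strictness; hence at least c + 1 entries of the row above are at most j - 1. *)
Lemma ssyt_count_strip j i :
  count_le j (nth [::] T i.+1) <= count_le j.-1 (nth [::] T i).
Proof.
have [_ row_sort col_lt] := T_ssyt; have [la_sort _ _] := and3P la_part.
case Dc: (count_le j (nth [::] T i.+1)) => [|c] //.
have lt_c1 : c < size (nth [::] T i.+1) by rewrite -Dc count_size.
have lt_c : c < size (nth [::] T i).
  by rewrite sizeT (leq_trans lt_c1) // sizeT part_antimono.
rewrite -nth_le_count //; have := col_lt i c lt_c1.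
have : nth 0 (nth [::] T i.+1) c <= j by rewrite nth_le_count // Dc.
lia.
Qed.

Lemma ssyt_count_anti j i :
  count_le j (nth [::] T i.+1) <= count_le j (nth [::] T i).
Proof.
by apply: leq_trans (ssyt_count_strip j i) _; apply: count_le_mono; apply: leq_pred.
Qed.

Hypothesis T_al : has_content al T.

Lemma content_count_le j : count_le j (flatten T) = sumn (take j al).
Proof.
elim: j => [|j IHj]; last by rewrite count_leS IHj T_al sumn_take_S.
(* The content at index 0 is the leading 0 of [0 :: al]: the entry 0 does not occur. *)
by rewrite take0 -[RHS](T_al 0); apply: eq_count => e; rewrite /= leqn0.
Qed.

Lemma content_entries e : e \in flatten T -> e <= size al.
Proof.
rewrite leqNgt => T_e; apply/negP => lt_e.
by move: T_e; apply/negP; rewrite -has_pred1 has_count T_al nth_default.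
Qed.

Lemma row_entries r e : r \in T -> e \in r -> e <= size al.
Proof. by move=> T_r r_e; apply: content_entries; apply/flattenP; exists r. Qed.

Lemma shape_le_oversize j : (forall e, e \in flatten T -> e <= j) -> shape_le j T = la.
Proof.
move=> le_j; have [la_sort la_pos _] := and3P la_part; have [shT _ _] := T_ssyt.
rewrite /shape_le (_ : [seq _ | r <- T] = la) ?(all_filterP la_pos) // -shT.
apply/eq_in_map => r T_r; apply: count_le_oversize => e r_e; apply: le_j.
by apply/flattenP; exists r.
Qed.

Lemma ssyt_strip_chain : strip_chain al (shape_le^~ T).
Proof.
split=> [j _|j _ i]; last first.
  rewrite !part_shape_le; try exact: ssyt_count_anti.
  by split; [apply: count_le_mono | apply: ssyt_count_strip].
rewrite /is_partition shape_le_pos sumn_shape_le content_count_le eqxx !andbT.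
exact/shape_le_sorted/ssyt_count_anti.
Qed.

(** The product in [wt] stops at the largest entry, which is at most [size al]; beyond it the shape
    stays [la], and the further factors are q-binomials with lower index 0. *)
Lemma ssyt_wt (q : rat) : (0 < q)%R ->
  wt q T = (\prod_(j < size al) strip_wt q (shape_le j.+1 T) (shape_le j T))%R.
Proof.
move=> q_gt0; have [_ chain_strip] := ssyt_strip_chain.
set M := foldr maxn 0 (flatten T).
have le_M e : e \in flatten T -> e <= M.
  rewrite /M; elim: (flatten T) => //= x s IHs; rewrite inE leq_max.
  by case/predU1P=> [->|/IHs->]; rewrite ?leqnn ?orbT.
have le_Mal : M <= size al.
  have := content_entries; rewrite /M; elim: (flatten T) => //= x s IHs le_s.
  by rewrite geq_max le_s ?mem_head //= IHs // => e s_e; rewrite le_s // inE s_e orbT.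
rewrite (@big_ord_widen_idx _ _ _ M (size al)
  (fun j => strip_wt q (shape_le j.+1 T) (shape_le j T)) le_Mal).
  rewrite /wt -/M big_add1 /= big_mkord; apply: eq_bigr => j _.
  rewrite big_mkord (@strip_wtE _ _ _ (size T)) //.
    by apply: chain_strip; apply: leq_trans le_Mal.
  by rewrite size_filter (leq_trans (count_size _ _)) ?size_map.
move=> j le_Mj; rewrite !shape_le_oversize => [|e /le_M|e /le_M]; try lia.
by rewrite /strip_wt big1 // => i _; rewrite subnn qbinom0.
Qed.

End Semistandard.

(** * From chains of shapes back to tableaux *)

Definition chain_row (f : nat -> nat) (k : nat) : seq nat :=
  flatten [seq nseq (f j - f j.-1) j | j <- iota 1 k].

Lemma chain_rowS f k : chain_row f k.+1 = chain_row f k ++ nseq (f k.+1 - f k) k.+1.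
Proof.
by rewrite /chain_row -{1}[k.+1]addn1 iotaD map_cat flatten_cat add1n /= cats0.
Qed.

Lemma chain_row_entries f k e : e \in chain_row f k -> e <= k.
Proof.
elim: k => [|k IHk] //; rewrite chain_rowS mem_cat => /orP[/IHk/leqW //|].
by rewrite mem_nseq => /andP[_ /eqP->].
Qed.

Lemma chain_row_sorted f k : sorted leq (chain_row f k).
Proof.
elim: k => [|k IHk] //; rewrite chain_rowS.
rewrite (sorted_pairwise leq_trans) pairwise_cat -!(sorted_pairwise leq_trans) IHk /=.
apply/andP; split.
  apply/allrelP => x y /chain_row_entries le_xk.
  by rewrite mem_nseq => /andP[_ /eqP->]; apply: leqW.
by elim: (_ - _) => //= c; case: c => //= c ->; rewrite leqnn.
Qed.

Section ChainRow.
Variables (f : nat -> nat) (k : nat).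
Hypotheses (f0 : f 0 = 0) (f_mono : forall j, j < k -> f j <= f j.+1).

Lemma count_le_chain_row j : count_le j (chain_row f k) = f (minn j k).
Proof.
elim: k f_mono => [|l IHl] fm; first by rewrite minn0 f0.
rewrite chain_rowS /count_le count_cat -/(count_le j _) IHl => [|i lt_i]; last first.
  by apply: fm; apply: leqW.
rewrite count_nseq; have [lt_lj|le_jl] := ltnP l j.
  by rewrite mul1n (minn_idPr lt_lj) subnKC ?fm.
by rewrite mul0n addn0 (minn_idPl (leqW le_jl)).
Qed.

Lemma size_chain_row : size (chain_row f k) = f k.
Proof.
rewrite -[in RHS](minnn k) -count_le_chain_row count_le_oversize //.
exact: chain_row_entries.
Qed.

End ChainRow.

(** Inverse to taking the chain of shapes: a box added at step j receives the entry j. [JF_flag] has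
    this form by definition. *)
Definition chain_tab (sh : nat -> seq nat) (k : nat) : tableau :=
  [seq chain_row (fun j => part (sh j) i) k | i <- iota 0 (size (sh k))].

Lemma eq_chain_tab sh1 sh2 k : (forall j, j <= k -> sh1 j = sh2 j) ->
  chain_tab sh1 k = chain_tab sh2 k.
Proof.
move=> E; rewrite /chain_tab E //; apply: eq_map => i; rewrite /chain_row.
congr flatten; apply/eq_in_map => j; rewrite mem_iota => /andP[j_gt0 lt_jk].
by rewrite !E //; lia.
Qed.

Section ChainTableau.
Variables (al : seq nat) (sh : nat -> seq nat).
Hypothesis sh_chain : strip_chain al sh.
Let k := size al.
Let T := chain_tab sh k.

Let sh0 i : part (sh 0) i = 0.
Proof.
have [/(_ 0 isT)] := sh_chain; rewrite take0 => /size_partition.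
by rewrite leqn0 => /nilP-> _; rewrite part_ge.
Qed.

Let sh_mono i j : j < k -> part (sh j) i <= part (sh j.+1) i.
Proof. by move=> lt_j; have [_ /(_ j lt_j i)[]] := sh_chain. Qed.

Let sh_k : is_partition (sumn al) (sh k).
Proof. by have [/(_ k (leqnn _))] := sh_chain; rewrite take_size. Qed.

Lemma nth_chain_tab i : nth [::] T i = chain_row (fun j => part (sh j) i) k.
Proof.
have [lt_i|le_i] := ltnP i (size (sh k)).
  by rewrite (nth_map 0) ?size_iota ?nth_iota.
rewrite nth_default ?size_map ?size_iota //; apply/esym/nilP.
by rewrite /nilp size_chain_row // ?part_ge // => j; apply: sh_mono.
Qed.

Lemma count_le_chain_tab j i : count_le j (nth [::] T i) = part (sh (minn j k)) i.
Proof.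
by rewrite nth_chain_tab (count_le_chain_row (f := fun j => part (sh j) i)) // => l; apply: sh_mono.
Qed.

Lemma chain_tab_entries e : e \in flatten T -> e <= k.
Proof. by case/flattenP=> r /mapP[i _ ->] /chain_row_entries. Qed.

Lemma shape_le_chain_tab j : j <= k -> shape_le j T = sh j.
Proof.
move=> le_j; have [/(_ j le_j)/and3P[sh_sort sh_pos _] _] := sh_chain.
apply: part_inj; rewrite ?shape_le_pos // => i.
rewrite part_shape_le => [|l]; rewrite !count_le_chain_tab (minn_idPl le_j) //.
exact: part_antimono.
Qed.

Lemma chain_tab_ssyt : is_ssyt_shape (sh k) T.
Proof.
split=> [|i|i c lt_c].
- rewrite /Defs.shape /T /chain_tab -map_comp -[RHS](mkseq_nth 0).
  by apply: eq_map => i /=; rewrite size_chain_row // => j; apply: sh_mono.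
- by rewrite nth_chain_tab chain_row_sorted.
have row_sort l : sorted leq (nth [::] T l) by rewrite nth_chain_tab chain_row_sorted.
set e := nth 0 (nth [::] T i.+1) c.
have : e <= e by []; rewrite {1}/e nth_le_count // count_le_chain_tab.
(* With min(e, k) = j + 1, the box in row [i.+1], column [c] lies in [sh j.+1]. The strip condition
   puts the box above it in [sh j], so the entry there is at most j < e. *)
case Dj: (minn e k) => [|j]; first by rewrite sh0.
have [lt_jk le_je] : j < k /\ j < e by lia.
have [_ /(_ j lt_jk i)[_ le_strip]] := sh_chain.
move=> /leq_trans/(_ le_strip); rewrite -{1}(minn_idPl (ltnW lt_jk)) -count_le_chain_tab => lt_cj.
apply: leq_ltn_trans le_je; rewrite nth_le_count //.
by apply: leq_trans lt_cj _; apply: count_size.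
Qed.

(** The multiplicity of j+1 is the difference of the sizes of two consecutive shapes. *)
Lemma chain_tab_content : has_content al T.
Proof.
have cnt j : count_le j (flatten T) = sumn (take j al).
  have [le_jk|lt_kj] := leqP j k.
    rewrite -sumn_shape_le shape_le_chain_tab //.
    by have [/(_ j le_jk)/and3P[_ _ /eqP->] _] := sh_chain.
  rewrite take_oversize ?(ltnW lt_kj) //; have [_ _ /eqP<-] := and3P sh_k.
  rewrite -(shape_le_chain_tab (leqnn k)) sumn_shape_le.
  apply: eq_in_count => e /chain_tab_entries le_ek.
  by rewrite le_ek (leq_trans le_ek) // ltnW.
case=> [|j]; last first.
  by apply/eqP; rewrite -(eqn_add2l (count_le j (flatten T))) -count_leS !cnt sumn_take_S.
transitivity (count_le 0 (flatten T)); last by rewrite cnt take0.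
by apply: eq_count => e; rewrite /= leqn0.
Qed.

End ChainTableau.

(** Consecutive differences of the counts give all multiplicities, and these determine a sorted
    list. *)
Lemma sorted_eq_count_le (r s : seq nat) :
  sorted leq r -> sorted leq s -> count_le^~ r =1 count_le^~ s -> r = s.
Proof.
move=> r_sort s_sort E; apply: (sorted_eq leq_trans anti_leq) => //.
apply/allP => -[|j] _ /=; last first.
  by have := E j.+1; rewrite !count_leS (E j : count_le j r = count_le j s) => /addnI->.
have c0 t : count_mem 0 t = count_le 0 t by apply: eq_count => e; rewrite /= leqn0.
by rewrite !c0 E.
Qed.

Lemma ssyt_chain_tab n al la T : is_partition n la -> is_ssyt_shape la T ->
  has_content al T -> chain_tab (shape_le^~ T) (size al) = T.
Proof.
move=> la_part T_ssyt T_al; have T_chain := ssyt_strip_chain la_part T_ssyt T_al.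
have sh_la := shape_le_oversize la_part T_ssyt (content_entries T_al).
have sizeT : size (chain_tab (shape_le^~ T) (size al)) = size T.
  by rewrite size_map size_iota sh_la; have [<- _ _] := T_ssyt; rewrite size_map.
apply: (@eq_from_nth _ [::]) => // i; rewrite sizeT => lt_i.
apply: sorted_eq_count_le => [||j]; first by rewrite nth_chain_tab // chain_row_sorted.
  by have [_ ->] := T_ssyt.
rewrite (count_le_chain_tab T_chain) part_shape_le; last exact: ssyt_count_anti la_part T_ssyt _.
apply: eq_in_count => e r_e.
have := row_entries T_al (mem_nth [::] lt_i) r_e; lia.
Qed.

End Tableaux.

(** * Counting by the tableau of a matrix, then summing over tableaux *)

Lemma JF_flagE (F : finFieldType) n al (N : 'M[F]_n) :
  JF_flag al N = chain_tab (JF_sh al N) (size al).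
Proof. by []. Qed.

Theorem theorem5p12 (F : finFieldType) (n : nat) (la al : seq nat)
  (Hla : is_partition n la) (Hal : is_weak_composition n al) :
  let q : rat := (#|F|%:R)^-1 in
  (forall T : tableau, is_ssyt_shape la T -> has_content al T ->
     wt q T = prefactor q n la al *
       (#|[set N : 'M[F]_n | in_nalpha al N && (JF_flag al N == T)]|)%:R)
  /\
  (forall ts : seq tableau, uniq ts ->
     (forall T, T \in ts <-> (is_ssyt_shape la T /\ has_content al T)) ->
     \sum_(T <- ts) wt q T = prefactor q n la al *
       (#|[set N : 'M[F]_n | in_nalpha al N && (JF N == la)]|)%:R).
Proof.
move=> q; have sum_al := eqP Hal.
have wtE T : is_ssyt_shape la T -> has_content al T ->
     wt q T = prefactor q n la al *
       (#|[set N : 'M[F]_n | in_nalpha al N && (JF_flag al N == T)]|)%:R.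
  move=> T_ssyt T_al; have T_chain := ssyt_strip_chain Hla T_ssyt T_al.
  rewrite (ssyt_wt Hla T_ssyt T_al (inv_card_gt0 F)) -(card_chain_mx F sum_al T_chain).
  rewrite (shape_le_oversize Hla T_ssyt (content_entries T_al)).
  congr (_ * _%:R); apply: eq_card => N; rewrite !in_set.
  case Nal: (in_nalpha al N) => //; have N_chain := nalpha_strip_chain sum_al Nal.
  (* A tableau and its chain of shapes determine each other, so equality of tableaux is equality of
     all the shapes. *)
  rewrite !andTb; apply/allP/eqP => [E | <- j].
    rewrite JF_flagE -[RHS](ssyt_chain_tab Hla T_ssyt T_al); apply: eq_chain_tab => j le_j.
    by apply/eqP/E; rewrite mem_iota.
  by rewrite mem_iota ltnS => le_j; rewrite JF_flagE (shape_le_chain_tab N_chain).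
split=> // ts ts_uniq tsP.
rewrite (eq_big_seq (fun T => prefactor q n la al *
    (#|[set N : 'M[F]_n | in_nalpha al N && (JF_flag al N == T)]|)%:R)); last first.
  by move=> T /tsP[T_ssyt T_al]; apply: wtE.
rewrite -mulr_sumr -natr_sum; congr (_ * _%:R).
(* Double counting of pairs (T, N): after the exchange each [N] contributes the number of [T] in
   [ts] equal to its tableau. *)
rewrite -sum1_card (eq_bigr (fun T =>
  \sum_(N in 'M[F]_n) (in_nalpha al N && (JF_flag al N == T) : nat))%N); last first.
  by move=> T _; rewrite -sum1_card big_mkcond; apply: eq_bigr => N _; rewrite inE; case: ifP.
rewrite exchange_big [RHS]big_mkcond; apply: eq_bigr => N _; rewrite inE.
case Nal: (in_nalpha al N); last by rewrite big1.
have N_chain := nalpha_strip_chain sum_al Nal.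
have JFE := JF_sh_last N sum_al.
(* The tableau of [N] is always semistandard of content [al] and shape [JF N], so only its shape
   decides membership in [ts]. *)
have -> : (JF N == la) = (JF_flag al N \in ts).
  apply/eqP/idP => [JFla | /tsP[[shT _ _] _]].
    apply/tsP; split; last by rewrite JF_flagE; apply: chain_tab_content.
    by rewrite -JFla -JFE JF_flagE; apply: chain_tab_ssyt.
  by rewrite -JFE -shT JF_flagE; have [->] := chain_tab_ssyt N_chain.
transitivity (JF_flag al N \in ts : nat)%N; last by case: (_ \in ts).
rewrite -(count_uniq_mem _ ts_uniq) -sum1_count [RHS]big_mkcond.
by apply: eq_bigr => T _; rewrite /= eq_sym; case: eqP.
Qed.
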